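(* Let $K\subset\mathbb{R}^2$ be a compact convex set with boundary of class $C^2$, symmetric with respect to the origin, and of area $F$. Let $w(R,\varphi)$ be the visual angle of $K$ at the point $P(R,\varphi)$ (defined for $R$ large), and let $w_\varphi$ denote its derivative with respect to $\varphi$. Then $$F=\frac{1}{8}\lim_{R\to\infty}\int_{0}^{2\pi}R^{2}\bigl(w(R,\varphi)^{2}-w_{\varphi}(R,\varphi)^{2}\bigr)\,d\varphi.$$
   Context: The support function of $K$ with respect to the origin is $p(\varphi)=\max_{(x,y)\in K}(x\cos\varphi+y\sin\varphi)$, a $2\pi$-periodic function. For $R>0$ large enough that the open disc of radius $R$ centered at the origin contains $K$, let $C_R$ be the circle of radius $R$ centered at the origin. The point $P(R,\varphi)\in C_R$ is the intersection of $C_R$ with the oriented support line of $K$ with outer normal $(\cos\varphi,\sin\varphi)$, taken in the direction $\varphi+\pi/2$; that is, $$P(R,\varphi)=p(\varphi)(\cos\varphi,\sin\varphi)+\sqrt{R^2-p(\varphi)^2}\,(-\sin\varphi,\cos\varphi).$$ The visual angle of $K$ from a point $P\notin K$ is the angle in $(0,\pi)$ under which $K$ is seen from $P$, i.e. the angle at $P$ of the smallest angular sector with vertex $P$ containing $K$ (the angle between the two support lines of $K$ through $P$). *)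

(* Defs.v *)
From HB Require Import structures.
From mathcomp Require Import all_boot all_order all_algebra.
From mathcomp Require Import all_classical all_reals all_analysis.

Set Implicit Arguments.
Unset Strict Implicit.
Unset Printing Implicit Defensive.

Import Order.TTheory GRing.Theory Num.Theory.
Import numFieldNormedType.Exports.

Local Open Scope ring_scope.
Local Open Scope classical_set_scope.

Definition C2_fun (R : realType) (f : R -> R) : Prop :=
  [/\ forall t, derivable f t 1,
      forall t, derivable f^`() t 1
    & continuous (f^`()^`())].

Definition boundary (T : topologicalType) (A : set T) : set T :=
  closure A `\` A°.

(* The boundary is a simple closed regular curve of class C^2, given by an
   L-periodic parametrization t |-> (x t, y t). The curvature is allowed to
   vanish. *)
Definition C2_boundary (R : realType) (K : set (R * R)) : Prop :=
  exists (L : R) (x y : R -> R),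
    [/\ 0 < L, periodic x L /\ periodic y L, C2_fun x /\ C2_fun y,
        forall t, (x^`() t, y^`() t) <> (0, 0)
      & (forall s t, 0 <= s < L -> 0 <= t < L ->
           x s = x t -> y s = y t -> s = t) /\
        boundary K = [set (x t, y t) | t in [set: R]]].

Definition convex_planar (R : realType) (K : set (R * R)) : Prop :=
  @convex_set R (R^o * R^o)%type K.

Definition symmetric_origin (R : realType) (K : set (R * R)) : Prop :=
  forall a b, K (a, b) -> K (- a, - b).

Definition area (R : realType) (K : set (R * R)) : \bar R :=
  (@lebesgue_measure R \x @lebesgue_measure R)%E K.

(* For a nonempty compact K this supremum is a maximum. *)
Definition support (R : realType) (K : set (R * R)) (phi : R) : R :=
  sup [set z.1 * cos phi + z.2 * sin phi | z in K].

(* The parameter r is the radius of the circle C_r. *)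
Definition circle_point (R : realType) (K : set (R * R)) (r phi : R) : R * R :=
  let p := support K phi in
  let q := Num.sqrt (r ^+ 2 - p ^+ 2) in
  (p * cos phi - q * sin phi, p * sin phi + q * cos phi).

(* Closed sector with vertex P, first side in direction theta, and opening a
   counterclockwise. *)
Definition angular_sector (R : realType) (P : R * R) (theta a : R)
    : set (R * R) :=
  [set z | exists rho s, [/\ 0 <= rho, theta <= s <= theta + a
     & z = (P.1 + rho * cos s, P.2 + rho * sin s)]].

(* Opening of the smallest sector with vertex P containing K; the infimum is
   attained when K is a compact convex set with interior and P is not in K. *)
Definition visual_angle (R : realType) (K : set (R * R)) (P : R * R) : R :=
  inf [set a | 0 < a < pi /\ exists theta, K `<=` angular_sector P theta a].

Definition w_angle (R : realType) (K : set (R * R)) (r phi : R) : R :=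
  visual_angle K (circle_point K r phi).

Definition integrand (R : realType) (K : set (R * R)) (r phi : R) : R :=
  r ^+ 2 * (w_angle K r phi ^+ 2 - derive1 (w_angle K r) phi ^+ 2).

(* Main.v *)
(* Let p be the support function of K and q = p', which exists off a countable
   set. If alpha(t) = asin (p t / r), the visual angle from P(r, t) is
   w = alpha(t) + alpha(t - w), because p has period pi. Hence r w -> 2 p, and
   differentiating this relation r w' -> 2 q wherever q is continuous; everything
   is bounded, so that the integral of r^2 (w^2 - w'^2) over a period tends to 4
   times that of p^2 - q^2. It remains to see that the latter is twice the area
   of K. Since the boundary may contain segments, where q jumps, this is not done
   by a change of variables but by comparing increments: between normals u < v,
   the area under the graph of the upper boundary differs from a trapezoid by at
   most (v - u) times the squared distance of the contact points, and that
   distance is bounded by an increment of the monotone function q + 2 L t. *)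
Require Import Defs.
From HB Require Import structures.
From mathcomp Require Import all_boot all_order all_algebra.
From mathcomp Require Import all_classical all_reals all_analysis.
From mathcomp Require Import measurable_realfun.
From mathcomp Require Import ring lra.

Set Implicit Arguments.
Unset Strict Implicit.
Unset Printing Implicit Defensive.

Import Order.TTheory GRing.Theory Num.Theory.
Import numFieldNormedType.Exports.

Local Open Scope ring_scope.
Local Open Scope classical_set_scope.

(** * Real analysis *)

Section real_analysis.
Context {R : realType}.
Implicit Types (f df D M m : R -> R) (a b t x : R).

(** The direct route, with F as half the integral of p (p + p''), is closed because p'' is only a
    measure, with atoms at the segments of the boundary. So [q] is not defined as a derivative but
    as the tangential component of an arbitrarily selected contact point. It then exists for every
    normal, and monotonicity of q + 2 L t gives its measurability, the countability of its jumps and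
    a modulus [M] at once. An error (v - u) (M v - M u) is small enough to identify an integral,
    since its sum over n equal parts is of order 1 / n. The same device serves for the angle: the
    formal derivatives of alpha and w are written with [q] for p', hence are defined, bounded and
    measurable everywhere, and they are the true ones off a countable set. The condition
    [8 * L <= r] makes alpha 1/2-Lipschitz, so that the equation for t - w has exactly one solution,
    which is Lipschitz in t. *)

Lemma is_derive_continuous f df :
  (forall x, is_derive x 1 f (df x)) -> continuous f.
Proof.
move=> fd x; apply: differentiable_continuous; apply/derivable1_diffP.
exact: (@ex_derive _ _ _ _ _ _ _ (fd x)).
Qed.

Lemma is_derive_MVT f df a b : (forall x, is_derive x 1 f (df x)) ->
  exists c, (a <= c <= b \/ b <= c <= a) /\ f b - f a = df c * (b - a).
Proof.
move=> fd; have cf := is_derive_continuous fd.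
case: (leP a b) => [ab|/ltW ba].
- have [c cab E] := MVT_segment ab (fun x _ => fd x) (continuous_subspaceT cf).
  by exists c; split => //; left; move: cab; rewrite in_itv.
- have [c cab E] := MVT_segment ba (fun x _ => fd x) (continuous_subspaceT cf).
  by exists c; split; [right; move: cab; rewrite in_itv|lra].
Qed.

Lemma is_derive_Lipschitz f df C a b :
  (forall x, is_derive x 1 f (df x)) -> (forall x, `|df x| <= C) ->
  `|f b - f a| <= C * `|b - a|.
Proof.
move=> fd dC; have [c [_ ->]] := is_derive_MVT a b fd.
by rewrite normrM ler_wpM2r.
Qed.

Lemma is_derive_Taylor1 f df C a b :
  (forall x, is_derive x 1 f (df x)) ->
  (forall x y, `|df y - df x| <= C * `|y - x|) -> 0 <= C ->
  `|f b - f a - df a * (b - a)| <= C * (b - a) ^+ 2.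
Proof.
move=> fd dC C0; have [c [cab ->]] := is_derive_MVT a b fd.
rewrite -mulrBl normrM -(real_normK (num_real (b - a))) expr2 mulrA.
rewrite ler_wpM2r// (le_trans (dC _ _))// ler_wpM2l//.
by case: cab => cab; [rewrite !ger0_norm|rewrite !ler0_norm]; lra.
Qed.

Lemma sin_Lipschitz a b : `|sin b - sin a| <= `|b - a|.
Proof.
rewrite -[leRHS]mul1r; apply: is_derive_Lipschitz (fun x => is_derive_sin x) _.
exact: cos_max.
Qed.

Lemma cos_Lipschitz a b : `|cos b - cos a| <= `|b - a|.
Proof.
rewrite -[leRHS]mul1r; apply: is_derive_Lipschitz (fun x => is_derive_cos x) _.
by move=> x; rewrite normrN sin_max.
Qed.

Lemma sin_Taylor1 a b : `|sin b - sin a - cos a * (b - a)| <= (b - a) ^+ 2.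
Proof.
rewrite -[leRHS]mul1r; apply: is_derive_Taylor1 (fun x => is_derive_sin x) _ _ => //.
by move=> x y; rewrite mul1r cos_Lipschitz.
Qed.

Lemma cos_Taylor1 a b : `|cos b - cos a + sin a * (b - a)| <= (b - a) ^+ 2.
Proof.
rewrite -[leRHS]mul1r -[X in _ + X]opprK -mulNr.
apply: is_derive_Taylor1 (fun x => is_derive_cos x) _ _ => //.
by move=> x y; rewrite mul1r opprK addrC (distrC y) sin_Lipschitz.
Qed.

Lemma sin_le x : 0 <= x -> sin x <= x.
Proof.
by move=> x0; have := sin_Lipschitz 0 x; rewrite sin0 !subr0 (ger0_norm x0) ler_norml => /andP[].
Qed.

Lemma normr_mul_le (A B a b : R) : `|A| <= a -> `|B| <= b -> `|A * B| <= a * b.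
Proof. by move=> hA hB; rewrite normrM ler_pM. Qed.

Lemma asin_Lipschitz (c x y : R) : 0 <= c < 1 -> `|x| <= c -> `|y| <= c ->
  `|asin y - asin x| <= (Num.sqrt (1 - c ^+ 2))^-1 * `|y - x|.
Proof.
move=> /andP[c0 c1]; wlog xy : x y / x <= y.
  by move=> wl hx hy; case: (leP x y) => [|/ltW] /wl; [exact|rewrite distrC (distrC x); exact].
move=> hx hy; have /andP[cx xc] : - c <= x <= c by rewrite -ler_norml.
have /andP[cy yc] : - c <= y <= c by rewrite -ler_norml.
have asin_range z : z \in `]x, y[%R -> -1 < z < 1.
  by rewrite in_itv/= => /andP[xz zy]; lra.
have [|d dxy ->] := @MVT_segment R asin (fun z => (Num.sqrt (1 - z ^+ 2))^-1) x y xy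
    (fun z zxy => is_derive1_asin (asin_range _ zxy)).
- apply: continuous_in_subspaceT => z; rewrite inE/= in_itv/= => /andP[xz zy].
  by apply: continuous_asin; lra.
rewrite normrM ler_wpM2r//; move: dxy; rewrite in_itv/= => /andP[xd dy].
have sc : 0 < Num.sqrt (1 - c ^+ 2) by rewrite sqrtr_gt0; nra.
rewrite ger0_norm ?invr_ge0 ?sqrtr_ge0// lef_pV2 ?posrE//; last first.
  by rewrite sqrtr_gt0; nra.
by rewrite ler_sqrt; nra.
Qed.

Lemma asin0 : asin (0 : R) = 0.
Proof. by rewrite -[in LHS]sin0 sinK// in_itv/=; have := pi_gt0 R; lra. Qed.

Lemma asin_ge0 x : 0 <= x <= 1 -> 0 <= asin x.
Proof.
move=> x01; rewrite leNgt; apply/negP => n.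
have := @asin_geNpi2 R x ltac:(lra) => h.
have := @sin_gt0_pihalf R (- asin x).
have := @sin_ge0_pi R (- asin x); rewrite sinN asinK ?in_itv/=; last lra.
have := pi_gt0 R => pi0 /(_ ltac:(lra)) s1 s2.
have x0 : x = 0 by lra.
by move: n; rewrite x0 asin0 ltxx.
Qed.

(** The lower bound is [sin y <= y] at [y = asin x]; the upper one is the Lipschitz bound between 0
    and [x], whose constant is the derivative at [x]. *)
Lemma asin_bounds x : 0 <= x < 1 -> x <= asin x <= x / Num.sqrt (1 - x ^+ 2).
Proof.
move=> x01; apply/andP; split.
  rewrite -[leLHS](@asinK _ x) ?in_itv/=; last lra.
  by rewrite sin_le// asin_ge0; lra.
have := @asin_Lipschitz x 0 x x01; rewrite normr0 (ger0_norm (_ : 0 <= x)); last lra.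
move=> /(_ ltac:(lra) ltac:(lra)); rewrite asin0 !subr0.
rewrite [`|asin x|]ger0_norm ?asin_ge0//; last lra.
by rewrite [`|x|]ger0_norm 1?mulrC//; lra.
Qed.

(* Each bisection of [[u, v]] halves the bound, so that no differentiability of
   [D] is needed. *)
Lemma increments_constant D M a b : a <= b ->
  (forall u v, a <= u -> u <= v -> v <= b ->
     `|D v - D u| <= (v - u) * (M v - M u)) ->
  D b = D a.
Proof.
move=> ab H.
have bisect n : forall u v, a <= u -> u <= v -> v <= b ->
    `|D v - D u| <= (2^-1) ^+ n * ((v - u) * (M v - M u)).
  elim: n => [|n IH] u v au uv vb; first by rewrite expr0 mul1r H.
  pose w := (u + v) / 2.
  have H1 := IH u w au ltac:(rewrite /w; lra) ltac:(rewrite /w; lra).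
  have H2 := IH w v ltac:(rewrite /w; lra) ltac:(rewrite /w; lra) vb.
  have -> : D v - D u = (D w - D u) + (D v - D w) by lra.
  apply: (le_trans (ler_normD _ _)); apply: (le_trans (lerD H1 H2)).
  by rewrite exprS /w; lra.
have lim0 : (fun n : nat => (2^-1) ^+ n * ((b - a) * (M b - M a))) @ \oo --> (0 : R).
  rewrite -[X in _ --> X](mul0r ((b - a) * (M b - M a))).
  by apply: cvgMl; apply: cvg_expr; rewrite ger0_norm; lra.
apply/eqP; rewrite -subr_eq0 -normr_le0.
apply: (ler_cvg_to (cvg_cst _) lim0).
by apply: nearW => n; exact: bisect.
Qed.

Let mu := @lebesgue_measure R.

Lemma bounded_integrable_itv f a b C : measurable_fun `[a, b] f ->
  (forall t, a <= t <= b -> `|f t| <= C) ->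
  mu.-integrable `[a, b] (EFin \o f).
Proof.
move=> mf fC; apply: measurable_bounded_integrable => //.
  by rewrite /mu /= lebesgue_measure_itv/=; case: ifP => _; rewrite ?ltry.
exists C; split; first exact: num_real.
by move=> y Cy t /=; rewrite in_itv/= => /fC /le_trans; apply; exact: ltW.
Qed.

Lemma Rintegral_itv_split f a b c : a <= b -> b <= c ->
  mu.-integrable `[a, c] (EFin \o f) ->
  \int[mu]_(t in `[a, c]) f t =
  \int[mu]_(t in `[a, b]) f t + \int[mu]_(t in `[b, c]) f t.
Proof.
move=> ab bc fi.
have := @Rintegral_itvB R f (BLeft a) (BRight c) b fi.
rewrite !bnd_simp => /(_ ab bc) E.
rewrite -(@Rintegral_itv_obnd_cbnd R b (BRight c) f); first by rewrite -/mu; rewrite -E; lra.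
apply: integrableS fi => //.
by move=> t /=; rewrite !in_itv/=; lra.
Qed.

Lemma Rintegral_cst_itv a b C : a <= b ->
  \int[mu]_(t in `[a, b]) (cst C) t = C * (b - a).
Proof.
move=> ab; rewrite Rintegral_cst// /mu /= lebesgue_measure_itv/= lte_fin.
by case: ltgtP ab => // -> _; rewrite subrr.
Qed.

(** On [u, v] the values of [G] stay within [M v - M u] of [G u], so the integral is [G u * (v - u)]
    up to (v - u) (M v - M u). Hence [B] minus the integral of [G] has increments at most twice that
    bound and is constant. *)
Lemma Rintegral_of_increments (G B M : R -> R) a b : a <= b ->
  mu.-integrable `[a, b] (EFin \o G) ->
  (forall u v, a <= u -> u < v -> v <= b ->
     `|B v - B u - G u * (v - u)| <= (v - u) * (M v - M u)) ->
  (forall u v, a <= u -> u <= v -> v <= b -> `|G v - G u| <= M v - M u) ->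
  \int[mu]_(t in `[a, b]) G t = B b - B a.
Proof.
move=> ab Gi HB HG.
pose D t := B t - \int[mu]_(s in `[a, t]) G s.
have Gsub u v : a <= u -> v <= b -> mu.-integrable `[u, v] (EFin \o G).
  move=> au vb; apply: integrableS Gi => //.
  by move=> t /=; rewrite !in_itv/=; lra.
suff : D b = D a.
  rewrite /D set_itv1 Rintegral_set1; lra.
apply: (@increments_constant D (fun t => 2 * M t)) => // u v au uv vb.
have [->|unv] := eqVneq u v; first by rewrite !subrr normr0 mul0r.
have {}uv : u < v by rewrite lt_neqAle unv.
rewrite /D (@Rintegral_itv_split G a u v)//; [|exact: ltW|exact: Gsub].
have iu C : mu.-integrable `[u, v] (EFin \o cst C).
  by apply: (@bounded_integrable_itv _ _ _ `|C|).
have mono t : u <= t <= v -> M t <= M v.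
  by move=> /andP[ut tv]; have := HG t v ltac:(lra) tv vb; move: (normr_ge0 (G v - G t)); lra.
have I1 : \int[mu]_(t in `[u, v]) G t <= (G u + (M v - M u)) * (v - u).
  rewrite -Rintegral_cst_itv; last exact: ltW.
  apply: le_Rintegral => //; [exact: Gsub|].
  move=> t; rewrite /= in_itv/= => /andP[ut tv].
  have := HG u t au ut ltac:(lra); have := mono t ltac:(lra).
  by rewrite ler_norml; lra.
have I2 : (G u - (M v - M u)) * (v - u) <= \int[mu]_(t in `[u, v]) G t.
  rewrite -Rintegral_cst_itv; last exact: ltW.
  apply: le_Rintegral => //; [exact: Gsub|].
  move=> t; rewrite /= in_itv/= => /andP[ut tv].
  have := HG u t au ut ltac:(lra); have := mono t ltac:(lra).
  by rewrite ler_norml; lra.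
have := HB u v au uv vb; rewrite !ler_norml; lra.
Qed.

(** At a discontinuity [m] jumps over an interval with rational ends. Two points that jump over the
    same interval would force any value between them to be both below and above it, so each [J q]
    has at most one point. *)
Lemma nondecreasing_countable_discontinuity m : nondecreasing_fun m ->
  countable [set t | ~ {for t, continuous m}].
Proof.
move=> mnd.
pose J (q : rat * rat) := [set t | (forall s, s < t -> m s <= ratr q.1) /\
  (forall s, t < s -> ratr q.2 <= m s)].
apply: (@sub_countable _ _ _ (\bigcup_(q in [set q : rat * rat | q.1 < q.2]) J q)).
  apply: subset_card_le => t /= nc; apply: contrapT => nJ; apply: nc.
  have notJ (a b : R) : a < b ->
      (exists2 s, s < t & a < m s) \/ (exists2 s, t < s & m s < b).
    move=> ab; have [q1] := rat_in_itvoo ab; rewrite in_itv/= => /andP[aq1 q1b].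
    have [q2] := rat_in_itvoo q1b; rewrite in_itv/= => /andP[q12 q2b].
    apply: contrapT => /not_orP[n1 n2]; apply: nJ.
    exists (q1, q2) => /=; first by rewrite -(ltr_rat R).
    split=> s /= st.
    - rewrite leNgt; apply/negP => h; apply: n1; exists s => //; lra.
    - rewrite leNgt; apply/negP => h; apply: n2; exists s => //; lra.
  have [ub lb] : (forall e, 0 < e -> exists2 s, t < s & m s < m t + e) /\
                 (forall e, 0 < e -> exists2 s, s < t & m t - e < m s).
    split => e e0.
    - have [[s st h]|//] := notJ (m t) (m t + e) ltac:(lra).
      have := mnd s t (ltW st); lra.
    - have [//|[s st h]] := notJ (m t - e) (m t) ltac:(lra).
      have := mnd t s (ltW st); lra.
  apply/cvgrPdist_lt => e e0.
  have [s1 ts1 h1] := ub e e0; have [s2 s2t h2] := lb e e0.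
  near=> s.
  have ss1 : s < s1 by near: s; exact: lt_nbhsl.
  have ss2 : s2 < s by near: s; exact: lt_nbhsr.
  have := mnd s s1 (ltW ss1); have := mnd s2 s (ltW ss2).
  by rewrite ltr_norml; lra.
apply: bigcup_countable => // q /= q12.
apply: finite_set_countable.
have [->|/set0P[t0 Jt0]] := eqVneq (J q) set0; first exact: finite_set0.
apply: (@sub_finite_set _ _ [set t0]) => // t Jt /=.
have [tt|tt|//] := ltgtP t t0.
- have [s /andP[s1 s2]] : exists s, t < s < t0 by exists ((t + t0) / 2); lra.
  have := Jt.2 s s1; have := Jt0.1 s s2; move: q12; rewrite -(ltr_rat R); lra.
- have [s /andP[s1 s2]] : exists s, t0 < s < t by exists ((t + t0) / 2); lra.
  have := Jt.1 s s2; have := Jt0.2 s s1; move: q12; rewrite -(ltr_rat R); lra.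
Unshelve. all: by end_near. Qed.

(** If [gA] and [gB] are the Caratheodory slopes of [A] and [B], then that of [chi] is gA / (gB o
    chi). The denominator cannot vanish: away from [chi t] by injectivity of [B], at [chi t] because
    it equals [beta] there. *)
Lemma is_derive_implicit (A B chi : R -> R) t (alpha beta : R) :
  is_derive t 1 A alpha -> is_derive (chi t) 1 B beta -> beta != 0 ->
  injective B -> {for t, continuous chi} -> (forall s, B (chi s) = A s) ->
  is_derive t 1 chi (alpha / beta).
Proof.
move=> /is_derive1_caratheodory[gA [EA cA gAt]].
move=> /is_derive1_caratheodory[gB [EB cB gBt]] beta0 Binj cchi BA.
apply/is_derive1_caratheodory; exists (fun s => gA s / gB (chi s)); split.
- move=> s; have gB0 : gB (chi s) != 0.
    apply/eqP => gB0; have := EB (chi s); rewrite gB0 mul0r => /subr0_eq/Binj E.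
    by move: gB0; rewrite E gBt => /eqP; apply/negP.
  have := EB (chi s); rewrite !BA EA => E.
  by rewrite mulrAC E mulrAC divff// mul1r.
- apply: cvgM => //; apply: cvgV; first by rewrite gBt.
  by apply: continuous_comp.
- by rewrite gAt gBt.
Qed.

Lemma near_dist_lt t (e : R) : 0 < e -> \forall s \near t, `|t - s| < e.
Proof. by move=> e0; apply: (@cvgr_dist_lt _ _ _ (nbhs t) _ idfun t cvg_id e). Qed.

Lemma cvg_of_dist_le (u e : nat -> R) (l : R) : (forall n, `|u n - l| <= e n) ->
  e n @[n --> \oo] --> 0 -> u n @[n --> \oo] --> l.
Proof.
move=> ue e0; apply: (@squeeze_cvgr _ _ _ _ (fun n => l - e n) (fun n => l + e n)).
- by apply: nearW => n; have := ue n; rewrite ler_norml; lra.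
- by rewrite -[X in _ --> X]subr0; apply: cvgB => //; exact: cvg_cst.
- by rewrite -[X in _ --> X]addr0; apply: cvgD => //; exact: cvg_cst.
Qed.

(** Every function is measurable on a countable set, so arbitrary values there do no harm. This
    disposes of the default values of a derivative at points where it does not exist. *)
Lemma measurable_eq_off_countable (A N : set R) f (g : R -> R) : measurable A ->
  countable N -> (forall t, ~ N t -> f t = g t) ->
  measurable_fun A g -> measurable_fun A f.
Proof.
move=> mA cN fg mg.
have mN : measurable N by apply: countable_measurable.
rewrite -(setUIDK A N).
apply/measurable_funU; [exact: measurableI|exact: measurableD|split].
- move=> _ Y mY; apply: countable_measurable => //.
  by apply: sub_countable cN; apply: subset_card_le => t [[]].
- apply: (eq_measurable_fun g); first by move=> t; rewrite inE => -[_ /fg].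
  by apply: measurable_funS mg => //; exact: subDsetl.
Qed.

Lemma integrable_subitv f a b (c d : R) : a <= c -> d <= b ->
  mu.-integrable `[a, b] (EFin \o f) -> mu.-integrable `[c, d] (EFin \o f).
Proof.
move=> ac db; apply: integrableS => // t /=; rewrite !in_itv/=; lra.
Qed.

Lemma affine_integrable a b (alpha beta : R) :
  mu.-integrable `[a, b] (EFin \o (fun s => alpha * s + beta)).
Proof.
apply: (@bounded_integrable_itv _ _ _ (`|alpha| * (`|a| + `|b|) + `|beta|)).
  by apply: measurable_funD => //; exact: measurable_funM.
move=> t atb; rewrite (le_trans (ler_normD _ _))// lerD2r normrM ler_wpM2l//.
have := ler_norm b; have := ler_norm (- a); have := normr_ge0 a; have := normr_ge0 b.
by rewrite normrN ler_norml; lra.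
Qed.

Lemma Rintegral_affine a b (alpha beta : R) : a <= b ->
  \int[mu]_(s in `[a, b]) (alpha * s + beta) =
  alpha * (b ^+ 2 - a ^+ 2) / 2 + beta * (b - a).
Proof.
move=> ab.
rewrite (@Rintegral_of_increments _ (fun s => alpha * s ^+ 2 / 2 + beta * s)
  (fun s => `|alpha| * s) a b ab); first by lra.
- exact: affine_integrable.
- move=> u v au uv vb.
  have -> : alpha * v ^+ 2 / 2 + beta * v - (alpha * u ^+ 2 / 2 + beta * u) -
    (alpha * u + beta) * (v - u) = alpha * ((v - u) ^+ 2 / 2) by lra.
  rewrite normrM (@ger0_norm _ (_ / 2)); last by rewrite divr_ge0 ?sqr_ge0.
  have -> : (v - u) * (`|alpha| * v - `|alpha| * u) = `|alpha| * (v - u) ^+ 2 by ring.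
  by rewrite ler_wpM2l//; have := sqr_ge0 (v - u); lra.
- move=> u v au uv vb.
  have -> : alpha * v + beta - (alpha * u + beta) = alpha * (v - u) by ring.
  by rewrite normrM (ger0_norm (_ : 0 <= v - u)) ?mulrBr//; lra.
Qed.

End real_analysis.

(** * Support function *)

Section support_function.
Context {R : realType}.
Implicit Types (K : set (R * R)) (x y : R -> R) (a b t u v L : R).

(* The component of [(a, b)] along [(cos t, sin t)]; [dot b (- a) t] is its
   component along the rotated vector [(- sin t, cos t)]. *)
Definition dot a b t := a * cos t + b * sin t.

Lemma dotN a b t : dot (- a) (- b) t = - dot a b t.
Proof. by rewrite /dot; lra. Qed.

Lemma dot_rot a b u v :
  dot a b v = dot a b u * cos (v - u) + dot b (- a) u * sin (v - u).
Proof.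
have [w ->] : exists w, v = u + w by exists (v - u); lra.
by rewrite (addrC u) addrK addrC /dot cosD sinD; ring.
Qed.

Lemma dotDpi a b t : dot a b (t + pi) = - dot a b t.
Proof. by rewrite /dot cosDpi sinDpi; ring. Qed.

Lemma dot_sqr a b t : dot a b t ^+ 2 + dot b (- a) t ^+ 2 = a ^+ 2 + b ^+ 2.
Proof.
rewrite -[RHS]mulr1 -(cos2Dsin2 t) /dot; ring.
Qed.

Lemma dot_bound a b t L : 0 <= L -> a ^+ 2 + b ^+ 2 <= L ^+ 2 ->
  `|dot a b t| <= L.
Proof.
move=> L0 abL; rewrite -(ger0_norm L0) -ler_sqr ?nnegrE// !real_normK ?num_real//.
by have := dot_sqr a b t; have := sqr_ge0 (dot b (- a) t); lra.
Qed.

Lemma is_derive_dot a b t : is_derive t 1 (dot a b) (dot b (- a) t).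
Proof.
rewrite /dot; apply: is_derive_eq.
by rewrite /GRing.scale/=; ring.
Qed.

Lemma dot_Lipschitz a b L u v : 0 <= L -> a ^+ 2 + b ^+ 2 <= L ^+ 2 ->
  `|dot a b v - dot a b u| <= L * `|v - u|.
Proof.
move=> L0 abL; apply: is_derive_Lipschitz (is_derive_dot a b) _ => t.
by apply: dot_bound => //; rewrite sqrrN addrC.
Qed.

Lemma dot_Taylor1 a b L u v : 0 <= L -> a ^+ 2 + b ^+ 2 <= L ^+ 2 ->
  `|dot a b v - dot a b u - dot b (- a) u * (v - u)| <= L * (v - u) ^+ 2.
Proof.
move=> L0 abL; apply: (is_derive_Taylor1 _ _ (is_derive_dot a b) _ L0) => s t.
by apply: dot_Lipschitz => //; rewrite sqrrN addrC.
Qed.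

(** One contact point is selected for each outer normal. Where the support line meets [K] in a
    segment the choice is arbitrary, so [x] and [y] may jump. *)
Definition support_point K x y := forall t, K (x t, y t) /\
  forall a b, K (a, b) -> dot a b t <= dot (x t) (y t) t.

Definition in_disc L K := forall a b, K (a, b) -> a ^+ 2 + b ^+ 2 <= L ^+ 2.

Lemma compact_in_disc K : compact K -> exists2 L, 0 < L & in_disc L K.
Proof.
move=> /compact_bounded/ex_strict_bound_gt0[M M0 KM].
(* The norm of the product is the maximum norm, so the radius must be at least sqrt 2 times [M]. *)
exists (M + M) => [|a b /KM/=]; first by lra.
rewrite prod_normE/= => abM.
have [aM bM] : `|a| < M /\ `|b| < M by split; apply: le_lt_trans abM; rewrite le_max lexx ?orbT.
move: aM bM; rewrite !ltr_norml => /andP[a1 a2] /andP[b1 b2]; nra.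
Qed.

Lemma support_point_exists K : compact K -> K !=set0 ->
  exists x y, support_point K x y.
Proof.
move=> cK K0.
have ex t : exists z, K z /\ forall a b, K (a, b) -> dot a b t <= dot z.1 z.2 t.
  have [|z zK zmax] := compact_EVT_max (f := fun z : R * R => dot z.1 z.2 t) K0 cK.
    apply: continuous_subspaceT => z; rewrite /dot.
    by apply: cvgD; apply: cvgMl; [exact: cvg_fst|exact: cvg_snd].
  by exists z; split; [exact/set_mem|move=> a b Kab; apply: (zmax (a, b)); exact/mem_set].
have [z zP] := choice ex.
exists (fun t => (z t).1), (fun t => (z t).2) => t.
by have [] := zP t; rewrite -surjective_pairing.
Qed.

Lemma support_pointE K x y t : support_point K x y ->
  Defs.support K t = dot (x t) (y t) t.
Proof.
move=> /(_ t)[Kz zmax]; apply/eqP; rewrite eq_le; apply/andP; split.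
  apply: ge_sup; first by exists (dot (x t) (y t) t), (x t, y t).
  by move=> _ [[a b] /= Kab <-]; exact: zmax.
apply: ub_le_sup; last by exists (x t, y t).
by exists (dot (x t) (y t) t) => _ [[a b] /= Kab <-]; exact: zmax.
Qed.

(** A chord with components [- d1], [d2] in the frame of the first normal has tangential component
    d1 s + d2 c in the frame of the second. The sum of the two tangential components dominates its
    length; the hypotheses say that each end of the chord lies behind the support line at the
    other. *)
Lemma chord_sqr_le (c s d1 d2 : R) : 0 <= c -> 0 < s -> c ^+ 2 + s ^+ 2 = 1 ->
  0 <= d1 -> d1 * c <= d2 * s ->
  0 <= d1 * s + d2 * (1 + c) /\
  d1 ^+ 2 + d2 ^+ 2 <= (d1 * s + d2 * (1 + c)) ^+ 2.
Proof.
move=> c0 s0 cs d10 dcs.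
have d20 : 0 <= d2.
  by rewrite -(pmulr_lge0 _ s0); apply: le_trans dcs; rewrite mulr_ge0.
split; first by rewrite addr_ge0 ?mulr_ge0//; lra.
have -> : (d1 * s + d2 * (1 + c)) ^+ 2 = d1 ^+ 2 + d2 ^+ 2 +
  (d1 * c * (d2 * s - d1 * c) + d1 * d2 * s * (2 + c) + d2 ^+ 2 * c * (2 + c)).
  have {1}-> : d1 ^+ 2 = d1 ^+ 2 * (c ^+ 2 + s ^+ 2) by rewrite cs mulr1.
  by ring.
rewrite lerDl !addr_ge0 ?mulr_ge0 ?subr_ge0 ?sqr_ge0 ?(ltW s0)//; lra.
Qed.

(** * Regularity of the support function and of its tangential component *)

Section support_selection.
Variables (K : set (R * R)) (x y : R -> R) (L : R).
Hypotheses (L0 : 0 < L) (KL : in_disc L K) (xyP : support_point K x y).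

(* [q] is the derivative of the support function [p] wherever [q] is
   continuous; the jumps of [q] are the lengths of the segments of the boundary. *)
Let p t := dot (x t) (y t) t.
Let q t := dot (y t) (- x t) t.
Let m t := q t + 2 * L * t.

Let xyL t : x t ^+ 2 + y t ^+ 2 <= L ^+ 2.
Proof. by apply: KL; exact: (xyP t).1. Qed.

Lemma support_normal_bound t : `|p t| <= L.
Proof. by apply: dot_bound => //; exact: ltW. Qed.

Lemma support_tangent_bound t : `|q t| <= L.
Proof. by apply: dot_bound; [exact: ltW|rewrite sqrrN addrC]. Qed.

Lemma support_Lipschitz u v : `|p v - p u| <= L * `|v - u|.
Proof.
have := dot_Lipschitz u v (ltW L0) (xyL u).
have := dot_Lipschitz u v (ltW L0) (xyL v).
have := (xyP u).2 _ _ (xyP v).1; have := (xyP v).2 _ _ (xyP u).1.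
rewrite -/(p u) -/(p v) !ler_norml; lra.
Qed.

(** An envelope argument: at [v] the support function is at least the sinusoid of the contact point
    of [u], and at [u] at least that of [v]. The two tangents enclose the error between 0 and (q v -
    q u) (v - u), up to the second-order terms of the sinusoids. *)
Lemma support_Taylor1 u v :
  `|p v - p u - q u * (v - u)| <= `|v - u| * (`|q v - q u| + 2 * L * `|v - u|).
Proof.
have := dot_Taylor1 u v (ltW L0) (xyL u).
have := dot_Taylor1 v u (ltW L0) (xyL v).
have := (xyP u).2 _ _ (xyP v).1; have := (xyP v).2 _ _ (xyP u).1.
rewrite -/(p u) -/(p v) -/(q u) -/(q v).
have : `|(q v - q u) * (v - u)| <= `|v - u| * `|q v - q u| by rewrite normrM mulrC.
have -> : `|v - u| * (`|q v - q u| + 2 * L * `|v - u|) =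
  `|v - u| * `|q v - q u| + 2 * L * (v - u) ^+ 2.
  by rewrite -(real_normK (num_real (v - u))); ring.
have := mulr_ge0 (ltW L0) (sqr_ge0 (v - u)).
have -> : L * (u - v) ^+ 2 = L * (v - u) ^+ 2 by ring.
rewrite !ler_norml; lra.
Qed.

Lemma is_derive_support t : {for t, continuous q} -> is_derive t 1 p (q t).
Proof.
move=> cq; apply/is_derive1_caratheodory.
exists (fun s => if s == t then q t else (p s - p t) / (s - t)).
split; last by rewrite /= eqxx.
  move=> s; case: eqVneq => [->|st]; first by rewrite !subrr mulr0.
  by rewrite divfK// subr_eq0.
apply/cvgrPdist_lt => e e0; near=> s; rewrite eqxx.
case: eqVneq => [_|st]; first by rewrite subrr normr0.
have st0 : s - t != 0 by rewrite subr_eq0.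
have nst : 0 < `|s - t| by rewrite normr_gt0.
rewrite -(ltr_pM2r nst) -normrM mulrBl divfK// distrC.
apply: (le_lt_trans (support_Taylor1 t s)).
rewrite mulrC ltr_pM2r//.
have h1 : `|q t - q s| < e / 2.
  by near: s; move/cvgrPdist_lt : cq; apply; rewrite divr_gt0.
have h2 : `|t - s| < e / (4 * L).
  by near: s; apply: near_dist_lt; rewrite divr_gt0//; have := L0; lra.
have h3 : 2 * L * `|s - t| < e / 2.
  rewrite distrC mulrC -ltr_pdivlMr; last by have := L0; lra.
  by rewrite -mulrA -invfM (_ : 2 * (2 * L) = 4 * L) //; ring.
by rewrite distrC; lra.
Unshelve. all: by end_near. Qed.

(** The tangential components of the chord in the frames of [u] and [v] each differ from [q v - q u]
    by at most L (v - u), the drift of a fixed point under rotation of the frame. The linear term of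
    [m] absorbs this drift, and the sum of the components dominates the chord. *)
Lemma support_point_increment u v : u <= v -> v - u <= pi / 2 ->
  0 <= m v - m u /\
  (x v - x u) ^+ 2 + (y v - y u) ^+ 2 <= (2 * (m v - m u)) ^+ 2.
Proof.
rewrite le_eqVlt => /predU1P[->|uv uvpi].
  by rewrite !subrr; move=> _; split => //; rewrite mulr0 expr0n/= addr0.
pose dx := x v - x u; pose dy := y v - y u.
have [s0 c0] : 0 < sin (v - u) /\ 0 <= cos (v - u).
  have := pi_gt0 R => pi0.
  by split; [apply: sin_gt0_pi|apply: cos_ge0_pihalf]; lra.
have d1 : 0 <= - dot dx dy u.
  by have := (xyP u).2 _ _ (xyP v).1; rewrite /dx /dy /dot; lra.
have dv : 0 <= dot dx dy v.
  by have := (xyP v).2 _ _ (xyP u).1; rewrite /dx /dy /dot; lra.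
rewrite (dot_rot _ _ u) in dv.
have [S0 S1] := @chord_sqr_le _ _ (- dot dx dy u) (dot dy (- dx) u) c0 s0
  (cos2Dsin2 _) d1 ltac:(lra).
have E : dot dy (- dx) v =
    - dot dx dy u * sin (v - u) + dot dy (- dx) u * cos (v - u).
  by rewrite (dot_rot _ _ u) /dot; ring.
have S2 : - dot dx dy u * sin (v - u) + dot dy (- dx) u * (1 + cos (v - u))
    <= 2 * (m v - m u).
  have -> : - dot dx dy u * sin (v - u) + dot dy (- dx) u * (1 + cos (v - u))
    = dot dy (- dx) v + dot dy (- dx) u by rewrite E; ring.
  have L1 := @dot_Lipschitz (y u) (- x u) L u v (ltW L0) ltac:(rewrite sqrrN addrC; exact: xyL).
  have L2 := @dot_Lipschitz (y v) (- x v) L u v (ltW L0) ltac:(rewrite sqrrN addrC; exact: xyL).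
  move: L1 L2; rewrite (gtr0_norm (_ : 0 < v - u)); last by lra.
  rewrite !ler_norml /m /q /dx /dy /dot => /andP[L1 _] /andP[L2 _].
  have Ld : 0 <= L * (v - u) by rewrite mulr_ge0 ?(ltW L0)//; lra.
  lra.
split; first by lra.
rewrite -/dx -/dy -(dot_sqr dx dy u) -[dot dx dy u ^+ 2]sqrrN.
apply: (le_trans S1); rewrite ler_sqr ?nnegrE//; lra.
Qed.

Lemma nondecreasing_support_tangent : nondecreasing_fun m.
Proof.
move=> u v uv; rewrite -subr_ge0.
have [h|h] := leP (v - u) (pi / 2); first exact: (support_point_increment uv h).1.
(* For distant normals [|q| <= L] suffices, since 2 L (v - u) is at least 2 L when v - u exceeds pi
   / 2. *)
have := support_tangent_bound u; have := support_tangent_bound v.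
rewrite !ler_norml /m; have := pi_ge2 R.
by have := L0; nra.
Qed.

Lemma measurable_support_tangent (A : set R) : measurable A -> measurable_fun A q.
Proof.
move=> mA; have -> : q = (fun t => m t - 2 * L * t) by apply/funext => t; rewrite /m; ring.
apply: measurable_funB; first exact: nondecreasing_measurable mA nondecreasing_support_tangent.
exact: measurable_funM.
Qed.

Lemma countable_support_corner : countable [set t | ~ {for t, continuous q}].
Proof.
apply: sub_countable (nondecreasing_countable_discontinuity nondecreasing_support_tangent).
apply: subset_card_le => t /= nq mc; apply: nq.
have -> : q = (fun t => m t - 2 * L * t) by apply/funext => s; rewrite /m; ring.
by apply: cvgB => //; apply: cvgMr; exact: cvg_id.
Qed.

Lemma continuous_support : continuous p.
Proof.
move=> t; apply/cvgrPdist_lt => e e0; near=> s.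
apply: (le_lt_trans (support_Lipschitz s t)).
rewrite mulrC -ltr_pdivlMr//; near: s.
by apply: near_dist_lt; rewrite divr_gt0.
Unshelve. all: by end_near. Qed.

End support_selection.
End support_function.

(** * Visual angle *)

Section visual_angle.
Context {R : realType}.
Implicit Types (K : set (R * R)) (a b s t u v : R).

Lemma polar_quadrant (U V : R) : 0 <= U -> 0 < V ->
  exists rho alpha : R, [/\ 0 < rho, 0 <= alpha < pi / 2,
    U = rho * sin alpha & V = rho * cos alpha].
Proof.
move=> U0 V0; pose alpha := atan (U / V).
have UV0 : 0 <= U / V by rewrite divr_ge0// ltW.
have a0 : 0 <= alpha by rewrite -(@atan0 R); exact: le_atan.
have a1 : alpha < pi / 2 by exact: atan_ltpi2.
have ca : 0 < cos alpha by apply: cos_gt0_pihalf; have := pi_gt0 R; lra.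
exists (V / cos alpha), alpha; split.
- by rewrite divr_gt0.
- by rewrite a0.
- have E : sin alpha / cos alpha = U / V := atanK (U / V).
  by rewrite -mulrA (mulrC (cos alpha)^-1) E mulrC divfK// gt_eqF.
- by rewrite divfK// gt_eqF.
Qed.

Lemma dot_inv a b t : a = dot a b t * cos t - dot b (- a) t * sin t /\
  b = dot a b t * sin t + dot b (- a) t * cos t.
Proof.
by rewrite /dot; split; [rewrite -[LHS]mulr1|rewrite -[LHS]mulr1];
  rewrite -(cos2Dsin2 t); ring.
Qed.

Lemma dot_polar rho s t : dot (rho * cos s) (rho * sin s) t = rho * cos (s - t).
Proof. by rewrite /dot cosB; ring. Qed.

Lemma dot_polar' rho s t : dot (rho * sin s) (- (rho * cos s)) t = rho * sin (s - t).
Proof. by rewrite /dot sinB; ring. Qed.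

(** This pins down the direction in which a contact point is seen from the vertex: along the support
    line with normal [t], backwards, hence at the angle t - pi / 2 modulo 2 pi. *)
Lemma sector_direction rho s t : 0 <= rho ->
  dot (rho * cos s) (rho * sin s) t = 0 ->
  dot (rho * sin s) (- (rho * cos s)) t < 0 ->
  cos (s - t) = 0 /\ sin (s - t) = - 1.
Proof.
rewrite dot_polar dot_polar' => rho0 /eqP; rewrite mulf_eq0 => /orP[/eqP->|/eqP c0].
  by rewrite mul0r ltxx.
move=> h; split => //; have sn : sin (s - t) < 0.
  by rewrite ltNge; apply/negP => s0; move: h; rewrite ltNge mulr_ge0.
have := cos2Dsin2 (s - t); rewrite c0 expr0n/= add0r => /eqP; rewrite sqrf_eq1.
by case/orP => /eqP // s1; move: sn; rewrite s1 ltr10.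
Qed.

(** Here [t] and [u + pi] are the outer normals of the two support lines through the vertex. Any
    admissible sector contains both contact directions, which are t - u apart; conversely the sector
    from u - pi / 2 to t - pi / 2 contains [K]. *)
Lemma visual_angleE K (P1 P2 : R) t u : 0 <= t - u < pi / 2 ->
  (forall a b, K (a, b) -> dot a b t <= dot P1 P2 t) ->
  (forall a b, K (a, b) -> dot P1 P2 u <= dot a b u) ->
  (exists a b, K (a, b) /\ dot a b t = dot P1 P2 t) ->
  (exists a b, K (a, b) /\ dot a b u = dot P1 P2 u) ->
  (forall a b, K (a, b) -> dot b (- a) t < dot P2 (- P1) t) ->
  (forall a b, K (a, b) -> dot b (- a) u < dot P2 (- P1) u) ->
  visual_angle K (P1, P2) = t - u.
Proof.
move=> /andP[w0 w1] Kt Ku [a1 [b1 [K1 E1]]] [a2 [b2 [K2 E2]]] Kt' Ku'.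
have pi0 := pi_gt0 R.
rewrite /visual_angle; set S := [set _ | _].
have lb A : S A -> t - u <= A.
  move=> /= [/andP[A0 Api] [theta sec]].
  have [rho1 [s1 [rho10 s1A [X1 Y1]]]] := sec _ K1.
  have [rho2 [s2 [rho20 s2A [X2 Y2]]]] := sec _ K2.
  have [c1 i1] : cos (s1 - t) = 0 /\ sin (s1 - t) = - 1.
    apply: (@sector_direction rho1) => //.
      by move: E1; rewrite X1 Y1 /dot /=; lra.
    by have := Kt' _ _ K1; rewrite X1 Y1 /dot /=; lra.
  have [c2 i2] : cos (s2 - u) = 0 /\ sin (s2 - u) = - 1.
    apply: (@sector_direction rho2) => //.
      by move: E2; rewrite X2 Y2 /dot /=; lra.
    by have := Ku' _ _ K2; rewrite X2 Y2 /dot /=; lra.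
  (* Only the cosine of the angle between the contact directions is known; it determines the angle
     because both angles lie in [0, pi]. *)
  have Ecos : cos `|s1 - s2| = cos (t - u).
    rewrite cos_norm (_ : s1 - s2 = (s1 - t) - (s2 - u) + (t - u)); last by lra.
    rewrite cosD (cosB (s1 - t)) (sinB (s1 - t)) c1 c2 i1 i2; ring.
  have s12 : `|s1 - s2| <= A by rewrite ler_norml; lra.
  rewrite -(cos_inj _ _ Ecos)// in_itv/=; last by lra.
  by rewrite normr_ge0; lra.
have mem A : t - u <= A -> 0 < A < pi -> S A.
  move=> wA A0; split => //; exists (u - pi / 2) => -[a b] Kab.
  (* [alpha] is the angle at the vertex between the first support line and the point [(a, b)]. *)
  have [||rho [alpha [rho0 a0 EU EV]]] := @polar_quadrant
      (- dot (a - P1) (b - P2) t) (- dot (b - P2) (- (a - P1)) t).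
  - by have := Kt _ _ Kab; rewrite /dot; lra.
  - by have := Kt' _ _ Kab; rewrite /dot; lra.
  have [Ea Eb] := dot_inv (a - P1) (b - P2) t.
  have {}EU : dot (a - P1) (b - P2) t = - (rho * sin alpha) by rewrite -EU opprK.
  have {}EV : dot (b - P2) (- (a - P1)) t = - (rho * cos alpha) by rewrite -EV opprK.
  have Da : a - P1 = rho * sin (t - alpha) by rewrite Ea EU EV sinB; ring.
  have Db : b - P2 = - (rho * cos (t - alpha)) by rewrite Eb EU EV cosB; ring.
  exists rho, (t - alpha - pi / 2); split.
  - exact: ltW.
  - apply/andP; split; last by lra.
    suff : alpha <= t - u by lra.
    rewrite leNgt; apply/negP => wa.
    have := Ku _ _ Kab.
    have -> : dot a b u = dot P1 P2 u + dot (a - P1) (b - P2) u by rewrite /dot; ring.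
    rewrite Da Db lerDl /dot.
    have -> : rho * sin (t - alpha) * cos u + - (rho * cos (t - alpha)) * sin u
      = - (rho * sin (alpha - (t - u))).
      rewrite -[alpha - (t - u)]opprK sinN (_ : - (alpha - (t - u)) = t - alpha - u); last by lra.
      by rewrite (sinB (t - alpha)); ring.
    rewrite oppr_ge0 leNgt mulr_gt0//; apply: sin_gt0_pihalf; lra.
  - rewrite cosBpihalf sinBpihalf -Da mulrN -Db.
    by congr pair; rewrite /=; lra.
have lbS : lbound S (t - u) by move=> A; exact: lb.
have S0 : S !=set0 by exists ((t - u + pi) / 2); apply: mem; lra.
apply/eqP; rewrite eq_le; apply/andP; split; last exact: lb_le_inf.
(* The opening t - u is not itself in [S] when it is 0, so the infimum is only approached: a
   midpoint between t - u and min (inf S, pi) lies in [S] and below [inf S]. *)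
rewrite leNgt; apply/negP => h.
have : t - u < Num.min (inf S) pi by rewrite lt_min h; lra.
set M := Num.min _ _ => hM.
have Mi : M <= inf S by rewrite ge_min lexx.
have Mp : M <= pi by rewrite ge_min lexx orbT.
have : inf S <= (t - u + M) / 2.
  by apply: ge_inf; [exists (t - u)|apply: mem; lra].
lra.
Qed.

End visual_angle.

(** * The visual angle from the circle *)

Section angle_function.
Context {R : realType}.
Variables (K : set (R * R)) (x y : R -> R) (L : R).
Hypotheses (L0 : 0 < L) (KL : in_disc L K) (xyP : support_point K x y).
Hypothesis K_sym : symmetric_origin K.
Implicit Types (r s t u v : R).

Let p t := dot (x t) (y t) t.
Let q t := dot (y t) (- x t) t.

Lemma support_symmetric_lower_bound a b t : K (a, b) -> - p t <= dot a b t.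
Proof.
by move=> /K_sym/(xyP t).2; rewrite dotN /p; lra.
Qed.

Lemma support_ge0 t : 0 <= p t.
Proof. by have := support_symmetric_lower_bound t (xyP t).1; rewrite /p; lra. Qed.

(** The angle at the circle point between the support line and the line to the origin, whose
    distance from the support line is [p t]. *)
Definition chord_half_angle r t : R := asin (p t / r).

Local Notation alpha := chord_half_angle.

Definition chord_half_angle' r t : R :=
  q t / r / Num.sqrt (1 - (p t / r) ^+ 2).

Section fixed_radius.
Variables (r : R) (rL : 8 * L <= r).

Let r0 : 0 < r. Proof. by have := L0; have := rL; lra. Qed.

Lemma support_ratio t : 0 <= p t / r <= 8^-1.
Proof.
rewrite divr_ge0 ?support_ge0 ?(ltW r0)//= ler_pdivrMr//.
have := support_normal_bound L0 KL xyP t; rewrite ler_norml -/(p t) => /andP[_].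
by have := rL; lra.
Qed.

Lemma sqrt_support_ratio t : 2^-1 <= Num.sqrt (1 - (p t / r) ^+ 2) <= 1.
Proof.
have /andP[h0 h1] := support_ratio t.
apply/andP; split.
  by rewrite -[leLHS]ger0_norm; [rewrite -sqrtr_sqr ler_sqrt; nra|lra].
by rewrite -[leRHS]sqrtr1 ler_sqrt; nra.
Qed.

Lemma chord_half_angle_bounds t :
  p t / r <= alpha r t <= p t / r / Num.sqrt (1 - (p t / r) ^+ 2).
Proof. by apply: asin_bounds; have := support_ratio t; lra. Qed.

Lemma chord_half_angle_le t : 0 <= alpha r t <= 2 * (p t / r).
Proof.
have /andP[h1 h2] := chord_half_angle_bounds t.
have /andP[h0 _] := support_ratio t.
have /andP[s1 _] := sqrt_support_ratio t.
apply/andP; split; first exact: le_trans h1.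
apply: (le_trans h2); rewrite mulrC ler_wpM2r// -[2]invrK lef_pV2// posrE; lra.
Qed.

(** [p / r] is 1/8-Lipschitz and the slope of [asin] on [- 1/8, 1/8] is at most 2. A constant below
    1 makes both u + alpha u and u - alpha u injective. *)
Lemma chord_half_angle_Lipschitz u v : `|alpha r v - alpha r u| <= 2^-1 * `|v - u|.
Proof.
have /andP[u0 u1] := support_ratio u; have /andP[v0 v1] := support_ratio v.
have := @asin_Lipschitz R 8^-1 (p u / r) (p v / r) ltac:(lra).
rewrite (ger0_norm u0) (ger0_norm v0) => /(_ u1 v1) /le_trans; apply.
have s1 : 2^-1 <= Num.sqrt (1 - 8^-1 ^+ 2) :> R.
  by rewrite -[leLHS]ger0_norm; [rewrite -sqrtr_sqr ler_sqrt; nra|lra].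
have s2 : (Num.sqrt (1 - 8^-1 ^+ 2))^-1 <= 2 :> R.
  by rewrite -[leRHS]invrK lef_pV2// posrE; lra.
rewrite -mulrBl normrM (@ger0_norm _ r^-1) ?invr_ge0 ?(ltW r0)//.
have pL := support_Lipschitz L0 KL xyP u v; rewrite -/(p u) -/(p v) in pL.
have : `|p v - p u| / r <= 8^-1 * `|v - u|.
  rewrite ler_pdivrMr//; apply: (le_trans pL).
  by move: (normr_ge0 (v - u)); have := rL; nra.
have pr0 : 0 <= `|p v - p u| / r by rewrite divr_ge0// ltW.
by move: s2 (normr_ge0 (v - u)); nra.
Qed.

Lemma is_derive_chord_half_angle t : {for t, continuous q} ->
  is_derive t 1 (alpha r) (chord_half_angle' r t).
Proof.
move=> cq; have dp := is_derive_support L0 KL xyP cq; rewrite -/(q t) in dp.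
have /andP[h0 h1] := support_ratio t.
have da : is_derive (p t / r) 1 asin (Num.sqrt (1 - (p t / r) ^+ 2))^-1.
  by apply: is_derive1_asin; lra.
have dpr : is_derive t 1 (fun s => p s / r) (q t / r).
  have -> : (fun s => p s / r) = (r^-1 \*: p) by apply/funext => s; rewrite /= mulrC.
  by apply: is_derive_eq; rewrite /GRing.scale/= mulrC.
have [g1 [E1 C1 G1]] := (is_derive1_caratheodory _ _ _).1 dpr.
have [g2 [E2 C2 G2]] := (is_derive1_caratheodory _ _ _).1 da.
apply/is_derive1_caratheodory; exists (fun s => g2 (p s / r) * g1 s); split.
- by move=> s; rewrite -mulrA -E1 -E2.
- apply: cvgM => //; apply: continuous_comp => //.
  by apply: cvgMl; exact: continuous_support L0 KL xyP t.
- by rewrite G1 G2 /chord_half_angle' mulrC.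
Qed.

Lemma chord_half_angle'_bound t : `|chord_half_angle' r t| <= 2 * L / r.
Proof.
have /andP[s1 _] := sqrt_support_ratio t.
have := support_tangent_bound L0 KL xyP t; rewrite -/(q t) => qL.
rewrite /chord_half_angle' !normrM !normfV (gtr0_norm r0).
rewrite (@ger0_norm _ (Num.sqrt _))//.
rewrite ler_pdivrMr; last by lra.
have : `|q t| / r <= L / r by rewrite ler_pM2r ?invr_gt0.
have Lr : 0 <= L / r by rewrite divr_ge0// ltW.
by rewrite -mulrA; nra.
Qed.

Lemma continuous_chord_half_angle : continuous (alpha r).
Proof.
move=> t; apply/cvgrPdist_lt => e e0; near=> s.
apply: (le_lt_trans (chord_half_angle_Lipschitz s t)).
apply: (@le_lt_trans _ _ `|t - s|); first by have := normr_ge0 (t - s); lra.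
by near: s; exact: near_dist_lt.
Unshelve. all: by end_near. Qed.

(* A point of the circle lies on the support line with normal [t] when its polar
   angle is [t + pi / 2 - alpha t]. The second support line through it has normal
   [u + pi], and then [u + alpha u = t - alpha t] since [alpha] has period [pi]. *)
Lemma second_normal_exists t : exists u, u + alpha r u = t - alpha r t.
Proof.
have at0 := chord_half_angle_le t; have at1 := chord_half_angle_le (t - 2).
have pt0 := support_ratio t; have pt1 := support_ratio (t - 2).
(* Any length of at least 1/2 would do, since alpha is at most 1/4. *)
have [|||u _ E] := @IVT R (fun u => u + alpha r u) (t - 2) t (t - alpha r t).
- by lra.
- apply: continuous_subspaceT => s.
  by apply: cvgD; [exact: cvg_id|exact: continuous_chord_half_angle].
- by rewrite ge_min le_max; apply/andP; split; apply/orP; [left|right]; lra.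
by exists u.
Qed.

Definition second_normal t : R := sval (cid (second_normal_exists t)).

Local Notation chi := second_normal.

Lemma second_normalE t : chi t + alpha r (chi t) = t - alpha r t.
Proof. by rewrite /second_normal; case: cid. Qed.

Lemma second_normal_dist t :
  t - chi t = alpha r t + alpha r (chi t).
Proof. by have := second_normalE t; lra. Qed.

Lemma second_normal_bounds t : 0 <= t - chi t <= 4 * (L / r).
Proof.
rewrite second_normal_dist.
have a1 := chord_half_angle_le t; have a2 := chord_half_angle_le (chi t).
have pr u : p u / r <= L / r.
  rewrite ler_pM2r ?invr_gt0//.
  by have := support_normal_bound L0 KL xyP u; rewrite ler_norml => /andP[].
have := pr t; have := pr (chi t); lra.
Qed.

Lemma injective_add_chord_half_angle : injective (fun u => u + alpha r u).
Proof.
move=> u v /= E; apply/eqP; rewrite -subr_eq0 -normr_le0.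
have := chord_half_angle_Lipschitz v u.
have -> : alpha r u - alpha r v = - (u - v) by lra.
by rewrite normrN; lra.
Qed.

(** By the defining equation the increment of [chi] is at most 3/2 of [|v - u|] plus half of itself;
    absorbing the latter gives 3. *)
Lemma second_normal_Lipschitz u v : `|chi v - chi u| <= 3 * `|v - u|.
Proof.
have h1 := chord_half_angle_Lipschitz u v.
have h2 := chord_half_angle_Lipschitz (chi u) (chi v).
have : `|chi v - chi u| <= `|v - u| + `|alpha r v - alpha r u| +
    `|alpha r (chi v) - alpha r (chi u)|.
  have -> : chi v - chi u = (v - u) - (alpha r v - alpha r u) -
    (alpha r (chi v) - alpha r (chi u)).
    by have := second_normalE u; have := second_normalE v; lra.
  by rewrite (le_trans (ler_normB _ _))// lerD2r (le_trans (ler_normB _ _)).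
lra.
Qed.

Lemma continuous_second_normal : continuous chi.
Proof.
move=> t; apply/cvgrPdist_lt => e e0; near=> s.
apply: (le_lt_trans (second_normal_Lipschitz s t)).
rewrite mulrC -ltr_pdivlMr; last by lra.
by near: s; apply: near_dist_lt; rewrite divr_gt0; lra.
Unshelve. all: by end_near. Qed.

Lemma injective_second_normal : injective chi.
Proof.
move=> u v E; have := second_normalE u; rewrite E second_normalE => E'.
apply/eqP; rewrite -subr_eq0 -normr_le0.
have := chord_half_angle_Lipschitz v u.
have -> : alpha r u - alpha r v = u - v by lra.
by lra.
Qed.

Lemma circle_pointE t : circle_point K r t =
  (- (r * sin (t - alpha r t)), r * cos (t - alpha r t)).
Proof.
have /andP[h0 h1] := support_ratio t.
rewrite /circle_point (support_pointE t xyP) -/(p t).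
have sa : p t = r * sin (alpha r t).
  by rewrite asinK ?in_itv/=; [rewrite mulrC divfK// gt_eqF|lra].
have ca : 0 <= cos (alpha r t) by rewrite cos_asin//; lra.
have -> : Num.sqrt (r ^+ 2 - p t ^+ 2) = r * cos (alpha r t).
  rewrite -[RHS]ger0_norm; last by rewrite mulr_ge0// ltW.
  rewrite -sqrtr_sqr; congr Num.sqrt.
  by rewrite sa -[X in X - _]mulr1 -(cos2Dsin2 (alpha r t)); ring.
by rewrite {1 2}sa sinB cosB; congr pair; ring.
Qed.

Lemma w_angleE t : w_angle K r t = t - chi t.
Proof.
have /andP[w0 w1] := second_normal_bounds t.
have /andP[at0 at1] := chord_half_angle_le t.
have /andP[au0 au1] := chord_half_angle_le (chi t).
have pt0 := support_ratio t; have pu0 := support_ratio (chi t).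
have pi1 := pihalf_ge1 R.
rewrite /w_angle circle_pointE.
set be := t - alpha r t.
have dotP s : dot (- (r * sin be)) (r * cos be) s = r * sin (s - be).
  by rewrite /dot sinB; ring.
have dotP' s : dot (r * cos be) (- - (r * sin be)) s = r * cos (s - be).
  by rewrite /dot cosB; ring.
have Et : r * sin (t - be) = p t.
  rewrite /be opprB addrCA subrr addr0 asinK ?in_itv/=; last by lra.
  by rewrite mulrC divfK// gt_eqF.
have Eu : r * sin (chi t - be) = - p (chi t).
  rewrite /be -second_normalE opprD addrA subrr add0r sinN asinK ?in_itv/=; last by lra.
  by rewrite mulrN mulrC divfK// gt_eqF.
(* The tangential coordinate of the circle point exceeds [L], so all of [K] lies behind it along
   both support lines. *)
have cos_alpha s : L < r * cos (alpha r s).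
  have hs := support_ratio s.
  rewrite cos_asin; last by lra.
  by have /andP[s1 _] := sqrt_support_ratio s; have := L0; have := rL; nra.
have tangent a b s : K (a, b) -> dot b (- a) s <= L.
  move=> Kab; apply: (le_trans (ler_norm _)); apply: dot_bound; first exact: ltW.
  by rewrite sqrrN addrC; exact: KL.
apply: visual_angleE; rewrite ?dotP ?dotP' ?Et ?Eu.
- by rewrite w0/= second_normal_dist; lra.
- by move=> a b /(xyP t).2.
- by move=> a b; exact: support_symmetric_lower_bound.
- by exists (x t), (y t); split => //; exact: (xyP t).1.
(* The second support line touches [K] at the antipode of the contact point with normal [chi t]. *)
- exists (- x (chi t)), (- y (chi t)); split; first exact/K_sym/(xyP _).1.
  by rewrite dotN.
- move=> a b /tangent /le_lt_trans; apply.
  by rewrite /be opprB addrCA subrr addr0.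
- move=> a b /tangent /le_lt_trans; apply.
  by rewrite /be -second_normalE opprD addrA subrr add0r cosN.
Qed.

(** The value of 1 - chi' found by differentiating the equation chi + alpha(chi) = t - alpha(t). *)
Definition angle_derivative t : R :=
  (chord_half_angle' r t + chord_half_angle' r (chi t)) /
  (1 + chord_half_angle' r (chi t)).

Lemma is_derive_w_angle t : {for t, continuous q} -> {for chi t, continuous q} ->
  is_derive t 1 (w_angle K r) (angle_derivative t).
Proof.
move=> cq cq'; have da := is_derive_chord_half_angle cq.
have db := is_derive_chord_half_angle cq'.
have b0 : 1 + chord_half_angle' r (chi t) != 0.
  have := chord_half_angle'_bound (chi t); rewrite ler_norml => /andP[h _].
  have : 2 * L / r <= 2^-1 by rewrite ler_pdivrMr//; have := rL; have := r0; lra.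
  by move=> h'; rewrite gt_eqF//; lra.
have dc : is_derive t 1 chi
    ((1 - chord_half_angle' r t) / (1 + chord_half_angle' r (chi t))).
  apply: (@is_derive_implicit _ (id - alpha r) (id + alpha r)) => //.
  - exact: injective_add_chord_half_angle.
  - exact: continuous_second_normal.
  - by move=> s; exact: second_normalE.
have -> : w_angle K r = id - chi by apply/funext => s; rewrite w_angleE.
by apply: is_derive_eq; rewrite /angle_derivative; field.
Qed.

Lemma angle_derivative_bound t : `|r * angle_derivative t| <= 8 * L.
Proof.
have h1 := chord_half_angle'_bound t; have h2 := chord_half_angle'_bound (chi t).
have h3 : 2 * L / r <= 2^-1 by rewrite ler_pdivrMr//; have := rL; have := r0; lra.
have h4 : 2^-1 <= 1 + chord_half_angle' r (chi t).
  by move: h2; rewrite ler_norml => /andP[h _]; lra.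
rewrite /angle_derivative !normrM normfV (gtr0_norm r0).
rewrite [`|1 + _|]gtr0_norm; last by lra.
rewrite mulrA ler_pdivrMr; last by lra.
have h5 : r * `|chord_half_angle' r t + chord_half_angle' r (chi t)| <= 4 * L.
  rewrite mulrC -ler_pdivlMr//; apply: (le_trans (ler_normD _ _)).
  have -> : 4 * L / r = 2 * L / r + 2 * L / r by rewrite -mulrDl; congr (_ / _); ring.
  exact: lerD.
by apply: (le_trans h5); have := L0; nra.
Qed.

End fixed_radius.
End angle_function.

(** * Area under the boundary *)

Section area_formula.
Context {R : realType}.
Implicit Types (K : set (R * R)) (a b c s t u v : R) (x y f Phi : R -> R).
Let mu := @lebesgue_measure R.

Lemma convex_planarE K : convex_planar K -> forall a b a' b' (l : R),
  0 <= l <= 1 -> K (a, b) -> K (a', b') ->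
  K (l * a + (1 - l) * a', l * b + (1 - l) * b').
Proof.
move=> cK a b a' b' l l01 K1 K2.
have /andP[l0 l1] := l01.
have := cK (a, b) (a', b') (Itv01 l0 l1) (mem_set K1) (mem_set K2).
by rewrite inE /conv/=; apply.
Qed.

Definition upper_graph K (w : R) f := forall s, - w <= s <= w ->
  K (s, f s) /\ forall b, K (s, b) -> b <= f s.

Lemma upper_graph_exists K w : compact K ->
  (forall s, - w <= s <= w -> exists b, K (s, b)) -> exists f, upper_graph K w f.
Proof.
move=> cK sec.
suff /choice[f fP] : forall s, exists b, - w <= s <= w ->
    K (s, b) /\ forall b', K (s, b') -> b' <= b by exists f.
move=> s; have [/sec[b0 Kb0]|] := boolP (- w <= s <= w); last by exists 0.
have cS : compact (K `&` [set z | z.1 = s]).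
  apply: compact_closedI => //.
  rewrite [X in closed X](_ : _ = fst @^-1` [set s])//.
  by apply: (closed_comp (fun z _ => @cvg_fst _ _ _ _ _)); exact: closed_eq.
have [||[a b] ab bmax] := compact_EVT_max (f := @snd R R) _ cS.
- by exists (s, b0).
- by apply: continuous_subspaceT => z; exact: cvg_snd.
exists b => _; move: ab; rewrite inE/= => -[Kab as_]; rewrite as_ in Kab.
split => // b' Kb'.
by apply: (bmax (s, b')); rewrite inE.
Qed.

(* [Phi] is an antiderivative of [- f], in a form that needs no regularity
   of [f]. *)
Definition affine_increments f Phi (w : R) := forall c1 c2 (alpha beta : R),
  - w <= c1 -> c1 <= c2 -> c2 <= w ->
  ((forall s, c1 <= s <= c2 -> f s <= alpha * s + beta) ->
    Phi c1 - Phi c2 <= alpha * (c2 ^+ 2 - c1 ^+ 2) / 2 + beta * (c2 - c1)) /\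
  ((forall s, c1 <= s <= c2 -> alpha * s + beta <= f s) ->
    alpha * (c2 ^+ 2 - c1 ^+ 2) / 2 + beta * (c2 - c1) <= Phi c1 - Phi c2).

Lemma affine_increments_right f (w : R) : mu.-integrable `[- w, w] (EFin \o f) ->
  affine_increments f (fun c => \int[mu]_(s in `[c, w]) f s) w.
Proof.
move=> fi c1 c2 alpha beta wc1 c12 c2w.
rewrite (@Rintegral_itv_split _ f c1 c2 w)//; last exact: integrable_subitv fi.
rewrite addrK -Rintegral_affine//.
have fi' : mu.-integrable `[c1, c2] (EFin \o f) by exact: integrable_subitv fi.
split=> h; apply: le_Rintegral => //; (try exact: affine_integrable) => s /=;
  rewrite in_itv/=; exact: h.
Qed.

(** This is again the integral of [f] from [c] to [w], written through the reflected function. The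
    lower boundary of [K] is the graph of - f(- s), so its share of the area appears in this
    form. *)
Lemma affine_increments_left f (w : R) :
  mu.-integrable `[- w, w] (EFin \o (fun s => f (- s))) ->
  affine_increments f (fun c => \int[mu]_(s in `[- w, - c]) f (- s)) w.
Proof.
move=> fi c1 c2 alpha beta wc1 c12 c2w.
rewrite (@Rintegral_itv_split _ (fun s => f (- s)) (- w) (- c2) (- c1)); last 3 first.
- lra.
- lra.
- by apply: integrable_subitv fi => //; lra.
rewrite addrAC subrr add0r.
have -> : alpha * (c2 ^+ 2 - c1 ^+ 2) / 2 + beta * (c2 - c1) =
  (- alpha) * ((- c1) ^+ 2 - (- c2) ^+ 2) / 2 + beta * (- c1 - - c2) by lra.
rewrite -Rintegral_affine; last by lra.
have fi' : mu.-integrable `[- c2, - c1] (EFin \o (fun s => f (- s))).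
  by apply: integrable_subitv fi => //; lra.
split=> h; apply: le_Rintegral => //; (try exact: affine_integrable) => s /=;
  rewrite in_itv/= => sc.
- by have := h (- s) ltac:(lra); lra.
- by have := h (- s) ltac:(lra); lra.
Qed.

(** * The upper boundary of a symmetric convex body as a concave graph *)

Section symmetric_body.
Variables (K : set (R * R)) (L : R).
Hypotheses (L0 : 0 < L) (KL : in_disc L K).
Hypotheses (K_convex : convex_planar K) (K_sym : symmetric_origin K).
Variables (w : R) (f : R -> R).
Hypothesis fP : upper_graph K w f.
Hypothesis Kw : forall a b, K (a, b) -> - w <= a <= w.

Lemma upper_graph_bound s : - w <= s <= w -> `|f s| <= L.
Proof.
move=> /fP[/KL h _].
rewrite -(ger0_norm (ltW L0)) -ler_sqr ?nnegrE// !real_normK ?num_real//.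
by have := sqr_ge0 s; lra.
Qed.

Lemma upper_graph_concave c1 c2 (y1 y2 l : R) : 0 <= l <= 1 ->
  K (c1, y1) -> K (c2, y2) ->
  l * y1 + (1 - l) * y2 <= f (l * c1 + (1 - l) * c2).
Proof.
move=> l01 K1 K2; have Kl := convex_planarE K_convex l01 K1 K2.
exact: (fP (Kw Kl)).2.
Qed.

Lemma upper_graph_chord c1 c2 (y1 y2 : R) s : c1 <= s <= c2 -> c1 < c2 ->
  K (c1, y1) -> K (c2, y2) ->
  (y2 - y1) / (c2 - c1) * s + (y1 - (y2 - y1) / (c2 - c1) * c1) <= f s.
Proof.
move=> /andP[cs sc] c12 K1 K2.
have d0 : 0 < c2 - c1 by lra.
have d1 : c2 - c1 != 0 by rewrite gt_eqF.
have := @upper_graph_concave c1 c2 y1 y2 ((c2 - s) / (c2 - c1)) _ K1 K2.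
rewrite divr_ge0 ?ler_pdivrMr//; try lra.
have -> : (c2 - s) / (c2 - c1) * c1 + (1 - (c2 - s) / (c2 - c1)) * c2 = s by field.
have -> : (c2 - s) / (c2 - c1) * y1 + (1 - (c2 - s) / (c2 - c1)) * y2 =
  (y2 - y1) / (c2 - c1) * s + (y1 - (y2 - y1) / (c2 - c1) * c1) by field.
by apply; lra.
Qed.

(** Superlevel sets of a concave function are intervals. *)
Lemma measurable_upper_graph : measurable_fun `[- w, w] f.
Proof.
apply: (measurability (@RGenCInfty.G R)) => [|/= _ [_] [r] -> <-].
  exact: RGenCInfty.measurableE.
apply: is_interval_measurable => s t/=.
rewrite !in_itv/= !andbT => -[sw fs] [tw ft] u /andP[su ut].
have uw : - w <= u <= w by lra.
rewrite in_itv/=; split => //; rewrite in_itv/= andbT.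
have [st|st] := eqVneq s t; first by have -> : u = s by lra.
have st' : s < t by rewrite lt_neqAle st; lra.
have d0 : 0 < t - s by lra.
have d1 : t - s != 0 by rewrite gt_eqF.
have := @upper_graph_concave s t (f s) (f t) ((t - u) / (t - s)) _ (fP sw).1 (fP tw).1.
have l0 : 0 <= (t - u) / (t - s) <= 1 by rewrite divr_ge0 ?ler_pdivrMr//; lra.
have -> : (t - u) / (t - s) * s + (1 - (t - u) / (t - s)) * t = u by field.
move=> /(_ l0) /(le_trans _); apply.
move: l0; set l := _ / _ => l0; nra.
Qed.

Lemma integrable_upper_graph : mu.-integrable `[- w, w] (EFin \o f).
Proof.
apply: (bounded_integrable_itv measurable_upper_graph (C := L)).
exact: upper_graph_bound.
Qed.

Lemma measurable_upper_graphN : measurable_fun `[- w, w] (fun s => f (- s)).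
Proof.
apply: (measurable_comp (F := `[- w, w]) (f := f)) => //.
- by move=> _ [s + <-]; rewrite /= !in_itv/= => /andP[h1 h2]; apply/andP; split; lra.
- exact: measurable_upper_graph.
Qed.

Lemma integrable_upper_graphN :
  mu.-integrable `[- w, w] (EFin \o (fun s => f (- s))).
Proof.
apply: (bounded_integrable_itv measurable_upper_graphN (C := L)).
by move=> t tw; apply: upper_graph_bound; lra.
Qed.

(** By central symmetry and convexity the vertical section over [s] is the segment from - f(- s) to
    f(s); the area follows by integrating its length. *)
Lemma area_upper_graph : area K =
  (\int[mu]_(s in `[- w, w]) f s + \int[mu]_(s in `[- w, w]) f (- s))%:E.
Proof.
rewrite -RintegralD//; [|exact: integrable_upper_graph|exact: integrable_upper_graphN].
have inti : mu.-integrable `[- w, w] (EFin \o (fun s => f s + f (- s))).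
  apply: (@bounded_integrable_itv _ _ _ _ (L + L)).
    by apply: measurable_funD; [exact: measurable_upper_graph|exact: measurable_upper_graphN].
  move=> t tw; rewrite (le_trans (ler_normD _ _))// lerD// upper_graph_bound//; lra.
rewrite /Rintegral fineK; last exact: integrable_fin_num.
rewrite /area /product_measure1 integral_mkcond; apply: eq_integral => s _ /=.
rewrite patchE; case: ifPn => [|] sw.
  have {}sw : - w <= s <= w by move: sw; rewrite inE/= in_itv.
  have sw' : - w <= - s <= w by lra.
  have Kg : K (s, - f (- s)) by have := K_sym (fP sw').1; rewrite opprK.
  have -> : xsection K s = `[- f (- s), f s].
    apply/seteqP; split => b /=; rewrite xsectionE ?in_itv/=.
      move=> Kb; rewrite (fP sw).2// andbT.
      by have := (fP sw').2 _ (K_sym Kb); lra.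
    have Kf := (fP sw).1.
    move=> /andP[fb bf].
    have [E|ne] := eqVneq (- f (- s)) (f s); first by have -> : b = f s by lra.
    have d0 : 0 < f s + f (- s) by rewrite lt_neqAle; apply/andP; split; [apply/eqP => E;
      move/eqP: ne; apply; lra|lra].
    have l01 : 0 <= (b + f (- s)) / (f s + f (- s)) <= 1.
      by rewrite divr_ge0 ?ler_pdivrMr//; lra.
    have := convex_planarE K_convex l01 Kf Kg.
    have d1 : f s + f (- s) != 0 by rewrite gt_eqF.
    by congr K; congr pair; field.
  have fg : - f (- s) <= f s by exact: (fP sw).2.
  rewrite lebesgue_measure_itv/= lte_fin; case: ltgtP fg => // [_ _|fg _].
    by rewrite -EFinB opprK.
  by congr EFin; lra.
have -> : xsection K s = set0.
  apply/seteqP; split => b //=; rewrite xsectionE => Kb.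
  by move/negP: sw; apply; rewrite inE/= in_itv/=; exact: Kw Kb.
by rewrite measure0.
Qed.

End symmetric_body.
End area_formula.

(** * Area and support function *)

Section cap.
Context {R : realType}.
Let mu := @lebesgue_measure R.

(** For [c], [s] the cosine and sine of an angle, the inequality keeps the vector [(B, A)] within
    that angle of the first axis, so [A] is at most its length times the sine. *)
Lemma sqr_le_cone (A B c s : R) : 0 <= A -> 0 <= c -> A * c <= B * s ->
  c ^+ 2 + s ^+ 2 = 1 -> A ^+ 2 <= (A ^+ 2 + B ^+ 2) * s ^+ 2.
Proof.
move=> A0 c0 AB cs.
have h : (A * c) ^+ 2 <= (B * s) ^+ 2.
  by rewrite ler_sqr ?nnegrE//; [rewrite mulr_ge0|apply: le_trans AB; rewrite mulr_ge0].
rewrite -[leLHS]mulr1 -cs; move: h; rewrite !exprMn; lra.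
Qed.

Lemma mul_le_of_sqr (A B D a b : R) : 0 <= A -> 0 <= B -> 0 <= D -> 0 <= a ->
  0 <= b -> A ^+ 2 <= D * a ^+ 2 -> B ^+ 2 <= D * b ^+ 2 -> A * B <= D * (a * b).
Proof.
move=> A0 B0 D0 a0 b0 hA hB.
rewrite -ler_sqr ?nnegrE ?mulr_ge0//.
have -> : (D * (a * b)) ^+ 2 = (D * a ^+ 2) * (D * b ^+ 2) by ring.
by rewrite exprMn ler_pM// sqr_ge0.
Qed.

(* [P], [Q] and [p], [q] are the components of two support points in the frame
   of the first normal, [c] and [s] the cosine and sine of the angle [d]
   between the normals. *)
Lemma cross_increment (p q d1 d2 S L d c s : R) :
  let P := p - d1 in let Q := q + d2 in
  0 < L -> 0 <= d <= 2 -> c ^+ 2 + s ^+ 2 = 1 ->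
  `|s| <= d -> `|s - d| <= d ^+ 2 -> `|c - 1| <= d ^+ 2 ->
  `|p| <= L -> `|q| <= L -> `|P| <= L -> `|Q| <= L ->
  `|d1| <= S * d -> `|d1| <= S -> `|d2| <= S ->
  `|p * d2 + q * d1 - (P * c + Q * s) * (- (P * s) + Q * c) + p * q
    - (p ^+ 2 - q ^+ 2) * d| <= d * (8 * L * S + 8 * L ^+ 2 * d).
Proof.
move=> P Q L0 /andP[d0 d2le] cs hs hsd hc hp hq hP hQ hd1 hd1' hd2.
have hd2L : `|d2| <= 2 * L.
  have -> : d2 = Q - q by rewrite /Q; lra.
  by rewrite (le_trans (ler_normB _ _))//; lra.
(* After cancellation every remaining term is of order [S * d] or [d ^ 2]. *)
have -> : p * d2 + q * d1 - (P * c + Q * s) * (- (P * s) + Q * c) + p * q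
    - (p ^+ 2 - q ^+ 2) * d =
  2 * (q * d1) + d1 * d2 + 2 * ((P * Q) * (s * s)) +
  ((P * P - Q * Q) * (s * (c - 1) + (s - d))) +
  (d2 * (Q + q) * (- d) + d1 * (P + p) * (- d)).
  have -> : (P * c + Q * s) * (- (P * s) + Q * c) =
    P * Q * (c ^+ 2 + s ^+ 2) - 2 * ((P * Q) * (s * s)) - (P * P - Q * Q) * (s * c).
    by ring.
  by rewrite cs /P /Q; ring.
have h1 : `|q * d1| <= L * (S * d) by exact: normr_mul_le.
have h2 : `|d1 * d2| <= S * d * (2 * L) by exact: normr_mul_le.
have h3 : `|P * Q * (s * s)| <= L * L * (d * d) by do 2?apply: normr_mul_le.
have h4 : `|P * P - Q * Q| <= L * L.
  have hPP : P * P <= L * L by apply: (le_trans (ler_norm _)); exact: normr_mul_le.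
  have hQQ : Q * Q <= L * L by apply: (le_trans (ler_norm _)); exact: normr_mul_le.
  have := sqr_ge0 P; have := sqr_ge0 Q; rewrite !expr2 ler_norml; lra.
have h5 : `|s * (c - 1) + (s - d)| <= d * d ^+ 2 + d ^+ 2.
  by rewrite (le_trans (ler_normD _ _))// lerD//; exact: normr_mul_le.
have h5' : d * d ^+ 2 + d ^+ 2 <= 3 * d ^+ 2.
  have := sqr_ge0 d; nra.
have h6 := normr_mul_le h4 (le_trans h5 h5').
have hQq : `|Q + q| <= 2 * L by rewrite (le_trans (ler_normD _ _))//; lra.
have hPp : `|P + p| <= 2 * L by rewrite (le_trans (ler_normD _ _))//; lra.
have hd : `|- d| <= d by rewrite normrN ger0_norm.
have h7 := normr_mul_le (normr_mul_le hd2 hQq) hd.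
have h8 := normr_mul_le (normr_mul_le hd1' hPp) hd.
move: h1 h2 h3 h6 h7 h8.
have -> : d * (8 * L * S + 8 * L ^+ 2 * d) = 8 * (L * (S * d)) + 8 * (L * L * (d * d)) by ring.
have -> : L * L * (3 * d ^+ 2) = 3 * (L * L * (d * d)) by ring.
have -> : S * d * (2 * L) = 2 * (L * (S * d)) by ring.
have -> : S * (2 * L) * d = 2 * (L * (S * d)) by ring.
have : 0 <= L * L * (d * d) by rewrite !mulr_ge0// ltW.
set e1 := q * d1; set e2 := d1 * d2; set e3 := P * Q * (s * s).
set e4 := (P * P - Q * Q) * _; set e5 := d2 * _ * _; set e6 := d1 * _ * _.
set LL := L * L * _; set LS := L * _.
rewrite !ler_norml; lra.
Qed.

(** * Increments of the area along the upper boundary *)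

Section cap_increments.
Variables (K : set (R * R)) (x y : R -> R) (L w : R) (f Phi : R -> R).
Hypotheses (L0 : 0 < L) (KL : in_disc L K) (K_convex : convex_planar K).
Hypotheses (xyP : support_point K x y) (fP : upper_graph K w f).
Hypothesis Kw : forall a b, K (a, b) -> - w <= a <= w.
Hypothesis fPhi : affine_increments f Phi w.

Let p t := dot (x t) (y t) t.
Let q t := dot (y t) (- x t) t.
Let m t := q t + 2 * L * t.

Lemma trapezoid_lower u v : x v <= x u ->
  (y u + y v) * (x u - x v) / 2 <= Phi (x v) - Phi (x u).
Proof.
move=> xvu.
have [wv _] : - w <= x v /\ x v <= w by apply/andP; exact: Kw (xyP v).1.
have [_ uw] : - w <= x u /\ x u <= w by apply/andP; exact: Kw (xyP u).1.
have [->|ne] := eqVneq (x v) (x u); first by rewrite !subrr mulr0 mul0r.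
have lt : x v < x u by rewrite lt_neqAle ne.
have d1 : x u - x v != 0 by rewrite subr_eq0 gt_eqF.
pose alpha := (y u - y v) / (x u - x v).
have [_] := fPhi alpha (y v - alpha * x v) wv xvu uw.
have -> : alpha * (x u ^+ 2 - x v ^+ 2) / 2 + (y v - alpha * x v) * (x u - x v) =
  (y u + y v) * (x u - x v) / 2.
  by rewrite /alpha; field.
apply => s sx.
exact: (upper_graph_chord K_convex fP Kw sx lt (xyP v).1 (xyP u).1).
Qed.

(** The graph stays below the support line with normal [tau]. The last factor on the right is the
    sum of the distances of the two contact points from that line; dividing by sin tau makes them
    vertical. *)
Lemma trapezoid_upper u v tau : x v <= x u -> 0 < sin tau ->
  (Phi (x v) - Phi (x u) - (y u + y v) * (x u - x v) / 2) * (2 * sin tau) <=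
  (x u - x v) * (2 * p tau - dot (x u) (y u) tau - dot (x v) (y v) tau).
Proof.
move=> xvu s0.
have [wv _] : - w <= x v /\ x v <= w by apply/andP; exact: Kw (xyP v).1.
have [_ uw] : - w <= x u /\ x u <= w by apply/andP; exact: Kw (xyP u).1.
have s1 : sin tau != 0 by rewrite gt_eqF.
have [h _] := fPhi (- cos tau / sin tau) (p tau / sin tau) wv xvu uw.
have {}h : Phi (x v) - Phi (x u) <=
    - cos tau / sin tau * (x u ^+ 2 - x v ^+ 2) / 2 + p tau / sin tau * (x u - x v).
  apply: h => s sx.
  have -> : - cos tau / sin tau * s + p tau / sin tau = (p tau - s * cos tau) / sin tau.
    by field.
  rewrite ler_pdivlMr//.
  by have := (xyP tau).2 _ _ (fP (_ : - w <= s <= w)).1; rewrite -/(p tau) /dot => /(_ ltac:(lra)); lra.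
have s2 : 0 < 2 * sin tau by lra.
rewrite -(ler_pM2r s2) in h.
rewrite mulrBl; apply: (le_trans (lerB h (lexx _))).
rewrite le_eqVlt; apply/orP; left; apply/eqP; rewrite /dot; field.
exact: s1.
Qed.

(** The division by sin tau is harmless for [tau = v] in the first quadrant and [tau = u] in the
    second: the width [x u - x v] is then at most the chord times sin tau, and the distance from the
    support line at most the chord times sin (v - u). Hence the separation of normals at pi / 2. *)
Lemma cap_increment u v : 0 <= u -> u < v -> v <= pi ->
  v <= pi / 2 \/ pi / 2 <= u ->
  0 <= Phi (x v) - Phi (x u) - (y u + y v) * (x u - x v) / 2 <=
    ((x v - x u) ^+ 2 + (y v - y u) ^+ 2) * (v - u) / 2.
Proof.
move=> u0 uv vpi uvpi; set D := _ + (y v - y u) ^+ 2.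
pose dx := x v - x u; pose dy := y v - y u.
have pi0 := pi_gt0 R.
have sd0 : 0 < sin (v - u) by apply: sin_gt0_pi; lra.
have cd0 : 0 <= cos (v - u) by apply: cos_ge0_pihalf; lra.
have du : dot dx dy u <= 0.
  by have := (xyP u).2 _ _ (xyP v).1; rewrite /dx /dy /dot; lra.
have dv : 0 <= dot dx dy v.
  by have := (xyP v).2 _ _ (xyP u).1; rewrite /dx /dy /dot; lra.
have su0 : 0 <= sin u by apply: sin_ge0_pi; lra.
have sv0 : 0 <= sin v by apply: sin_ge0_pi; lra.
have dx0 : dx <= 0.
  (* Eliminating [dy] between the two support inequalities shows that abscissas decrease along the
     upper boundary. *)
  have : dx * sin (v - u) <= 0.
    have -> : dx * sin (v - u) = dot dx dy u * sin v - dot dx dy v * sin u.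
      by rewrite sinB /dot; ring.
    by rewrite subr_le0 (@le_trans _ _ 0)// ?mulr_ge0// mulr_le0_ge0.
  by rewrite pmulr_lle0.
have xvu : x v <= x u by rewrite /dx in dx0; lra.
rewrite subr_ge0 trapezoid_lower//=.
have D0 : 0 <= D by rewrite addr_ge0 ?sqr_ge0.
have DE t : D = dot dx dy t ^+ 2 + dot dy (- dx) t ^+ 2 by rewrite dot_sqr.
suff [tau [st ht]] : exists tau, 0 < sin tau /\
    (x u - x v) * (2 * p tau - dot (x u) (y u) tau - dot (x v) (y v) tau) <=
    D * (sin tau * sin (v - u)).
  rewrite -(ler_pM2r (_ : 0 < 2 * sin tau)); last by lra.
  apply: (le_trans (trapezoid_upper xvu st)); apply: (le_trans ht).
  have -> : D * (v - u) / 2 * (2 * sin tau) = D * (sin tau * (v - u)) by lra.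
  by rewrite !ler_wpM2l ?(ltW st)// sin_le//; lra.
case: uvpi => uvpi.
- have st : 0 < sin v by apply: sin_gt0_pi; lra.
  exists v; split => //.
  have -> : 2 * p v - dot (x u) (y u) v - dot (x v) (y v) v = dot dx dy v.
    by rewrite /p /dx /dy /dot; ring.
  apply: mul_le_of_sqr => //; [lra|exact: ltW| |].
  + have -> : D = (x u - x v) ^+ 2 + dy ^+ 2 by rewrite /D -/dx -/dy /dx; ring.
    apply: (@sqr_le_cone _ _ (cos v)); first lra.
    * by apply: cos_ge0_pihalf; lra.
    * by move: dv; rewrite /dot /dx /dy; lra.
    * exact: cos2Dsin2.
  + rewrite (DE v); apply: (@sqr_le_cone _ _ (cos (v - u))) => //.
      move: du; rewrite (dot_rot _ _ v).
      by rewrite -(opprB v u) cosN sinN; lra.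
    exact: cos2Dsin2.
- have st : 0 < sin u by apply: sin_gt0_pi; lra.
  exists u; split => //.
  have -> : 2 * p u - dot (x u) (y u) u - dot (x v) (y v) u = - dot dx dy u.
    by rewrite /p /dx /dy /dot; ring.
  apply: mul_le_of_sqr => //; [lra|lra|exact: ltW| |].
  + have -> : D = (x u - x v) ^+ 2 + (- dy) ^+ 2 by rewrite /D -/dx -/dy /dx; ring.
    apply: (@sqr_le_cone _ _ (- cos u)); first lra.
    * have /cos_ge0_pihalf : - (pi / 2) <= u - pi <= pi / 2 by lra.
      by rewrite cosB cospi sinpi; lra.
    * by move: du; rewrite /dot /dx /dy; lra.
    * by rewrite sqrrN; exact: cos2Dsin2.
  + rewrite (DE u) -[dot dx dy u ^+ 2]sqrrN.
    apply: (@sqr_le_cone _ _ (cos (v - u))) => //; first lra.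
      by move: dv; rewrite (dot_rot _ _ u); lra.
    exact: cos2Dsin2.
Qed.

(* The area swept up to normal [t] by the segment from the foot of the
   perpendicular to the support line, formally of density [(p ^+ 2 - q ^+ 2) / 2];
   it does not depend on the choice of the support point. *)
Definition cap_area t : R := Phi (x t) + x t * y t / 2 - p t * q t / 2.

(** The increment splits into [E], the region between graph and chord, and half of x u y v - x v y u
    minus the increment of p q. The latter is expanded in the frame of [u]. *)
Lemma cap_area_increment u v : 0 <= u -> u < v -> v <= pi ->
  v <= pi / 2 \/ pi / 2 <= u ->
  `|cap_area v - cap_area u - (p u ^+ 2 - q u ^+ 2) / 2 * (v - u)| <=
  (v - u) * ((12 * L * m v + 4 * L ^+ 2 * v) - (12 * L * m u + 4 * L ^+ 2 * u)).
Proof.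
move=> u0 uv vpi uvpi; have := cap_increment u0 uv vpi uvpi => /=.
have pi0 := pi_gt0 R.
have uvpi2 : v - u <= pi / 2 by lra.
have pi4 := pihalf_lt2 R.
have [m0 mD] := support_point_increment L0 KL xyP (ltW uv) uvpi2.
rewrite -/(q u) -/(q v) -/(m u) -/(m v) in m0 mD.
set S := 2 * (m v - m u) in mD.
set D := _ + _ in mD *; set E := Phi _ - _ - _ => /andP[E0 ED].
pose dx := x v - x u; pose dy := y v - y u.
pose d1 := - dot dx dy u; pose d2 := dot dy (- dx) u.
have DE : D = d1 ^+ 2 + d2 ^+ 2 by rewrite /d1 /d2 sqrrN dot_sqr.
have S0 : 0 <= S by rewrite /S; lra.
have d0 : 0 <= v - u <= 2 by lra.
have d1S : `|d1| <= S.
  by rewrite -(ger0_norm S0) -ler_sqr ?nnegrE// !real_normK ?num_real//; have := sqr_ge0 d2; lra.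
have d2S : `|d2| <= S.
  by rewrite -(ger0_norm S0) -ler_sqr ?nnegrE// !real_normK ?num_real//; have := sqr_ge0 d1; lra.
have sd0 : 0 < sin (v - u) by apply: sin_gt0_pi; lra.
have cd0 : 0 <= cos (v - u) by apply: cos_ge0_pihalf; lra.
have d10 : 0 <= d1.
  by have := (xyP u).2 _ _ (xyP v).1; rewrite /d1 /dx /dy /dot; lra.
have sle : sin (v - u) <= v - u by apply: sin_le; lra.
have d1Sd : `|d1| <= S * (v - u).
  have h : d1 ^+ 2 <= D * sin (v - u) ^+ 2.
    rewrite DE; apply: (@sqr_le_cone _ _ (cos (v - u))) => //; last exact: cos2Dsin2.
    have := (xyP v).2 _ _ (xyP u).1.
    have -> : dot (x v) (y v) v = dot (x u) (y u) v + dot dx dy v.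
      by rewrite /dx /dy /dot; ring.
    by rewrite (dot_rot dx dy u) /d1 /d2; lra.
  have h' : d1 ^+ 2 <= (S * sin (v - u)) ^+ 2.
    by apply: (le_trans h); rewrite exprMn ler_wpM2r ?sqr_ge0.
  rewrite ger0_norm//; apply: (@le_trans _ _ (S * sin (v - u))); last by rewrite ler_wpM2l.
  by move: h'; rewrite ler_sqr ?nnegrE// mulr_ge0// ltW.
have tp t := support_normal_bound L0 KL xyP t.
have tq t := support_tangent_bound L0 KL xyP t.
rewrite -/p in tp; rewrite -/q in tq.
have zL : x v ^+ 2 + y v ^+ 2 <= L ^+ 2 by apply: KL; exact: (xyP v).1.
have PE : p u - d1 = dot (x v) (y v) u by rewrite /p /d1 /dx /dy /dot; ring.
have QE : q u + d2 = dot (y v) (- x v) u by rewrite /q /d2 /dx /dy /dot; ring.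
have PL : `|p u - d1| <= L by rewrite PE; apply: dot_bound => //; exact: ltW.
have QL : `|q u + d2| <= L.
  by rewrite QE; apply: dot_bound; [exact: ltW|rewrite sqrrN addrC].
have T1 := sin_Taylor1 0 (v - u); rewrite sin0 cos0 subr0 mul1r subr0 in T1.
have T2 := cos_Taylor1 0 (v - u); rewrite sin0 cos0 mul0r addr0 subr0 in T2.
have snorm : `|sin (v - u)| <= v - u by rewrite gtr0_norm.
have main := cross_increment L0 d0 (cos2Dsin2 (v - u)) snorm T1 T2 (tp u) (tq u)
  PL QL d1Sd d1S d2S.
have pvE : p v = (p u - d1) * cos (v - u) + (q u + d2) * sin (v - u).
  by rewrite PE QE /p (dot_rot _ _ u).
have qvE : q v = - ((p u - d1) * sin (v - u)) + (q u + d2) * cos (v - u).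
  by rewrite PE QE /q (dot_rot _ _ u) /dot; ring.
rewrite -pvE -qvE in main.
have crossE : p u * d2 + q u * d1 = x u * y v - x v * y u.
  rewrite -[RHS]mulr1 -(cos2Dsin2 u) /p /q /d1 /d2 /dx /dy /dot; ring.
rewrite crossE in main.
have -> : cap_area v - cap_area u - (p u ^+ 2 - q u ^+ 2) / 2 * (v - u) =
  E + (x u * y v - x v * y u - p v * q v + p u * q u
    - (p u ^+ 2 - q u ^+ 2) * (v - u)) / 2.
  by rewrite /cap_area /E; lra.
have DLS : D <= 4 * L * S.
  have d1L : `|d1| <= 2 * L.
    have -> : d1 = p u - (p u - d1) by lra.
    by rewrite (le_trans (ler_normB _ _))//; have := tp u; lra.
  have d2L : `|d2| <= 2 * L.
    have -> : d2 = (q u + d2) - q u by lra.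
    by rewrite (le_trans (ler_normB _ _))//; have := tq u; lra.
  rewrite DE !expr2.
  have := le_trans (ler_norm _) (normr_mul_le d1L d1S).
  have := le_trans (ler_norm _) (normr_mul_le d2L d2S).
  lra.
have ED' : E <= 2 * L * S * (v - u).
  apply: (le_trans ED); have -> : 2 * L * S * (v - u) = 4 * L * S * (v - u) / 2 by lra.
  by rewrite ler_pM2r ?invr_gt0// ler_wpM2r//; lra.
rewrite (le_trans (ler_normD _ _))// (ger0_norm E0) normrM (@ger0_norm _ 2^-1)//.
apply: (@le_trans _ _ (2 * L * S * (v - u) +
    (v - u) * (8 * L * S + 8 * L ^+ 2 * (v - u)) / 2)).
  by apply: lerD => //; rewrite ler_pM2r ?invr_gt0.
(* With S twice the increment of [m], [E] contributes 2 L S and the cross terms 4 L S + 4 L^2 (v -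
   u), each times v - u. *)
have -> : (v - u) * (12 * L * m v + 4 * L ^+ 2 * v - (12 * L * m u + 4 * L ^+ 2 * u)) =
  2 * L * S * (v - u) + (v - u) * (8 * L * S + 8 * L ^+ 2 * (v - u)) / 2.
  by rewrite /S; field.
exact: lexx.
Qed.

(** The modulus is that of the area increments, because identifying the integral takes one [M] for
    both estimates. *)
Lemma pedal_density_increment u v : u <= v ->
  `|(p v ^+ 2 - q v ^+ 2) / 2 - (p u ^+ 2 - q u ^+ 2) / 2| <=
  (12 * L * m v + 4 * L ^+ 2 * v) - (12 * L * m u + 4 * L ^+ 2 * u).
Proof.
move=> uv.
have tp t := support_normal_bound L0 KL xyP t.
have tq t := support_tangent_bound L0 KL xyP t.
rewrite -/p in tp; rewrite -/q in tq.
have m0 := nondecreasing_support_tangent L0 KL xyP uv.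
rewrite -/(q u) -/(q v) -/(m u) -/(m v) in m0.
have hp := support_Lipschitz L0 KL xyP u v; rewrite -/(p u) -/(p v) in hp.
have qm : `|q v - q u| <= m v - m u + 2 * L * (v - u).
  have h : 0 <= L * (v - u) by rewrite mulr_ge0 ?(ltW L0)//; lra.
  by rewrite ler_norml; move: m0; rewrite /m; lra.
have sp : `|p v + p u| <= 2 * L.
  by rewrite (le_trans (ler_normD _ _))//; have := tp u; have := tp v; lra.
have sq : `|q v + q u| <= 2 * L.
  by rewrite (le_trans (ler_normD _ _))//; have := tq u; have := tq v; lra.
rewrite (ger0_norm (_ : 0 <= v - u)) in hp; last by lra.
have h1 := normr_mul_le hp sp; have h2 := normr_mul_le qm sq.
have -> : (p v ^+ 2 - q v ^+ 2) / 2 - (p u ^+ 2 - q u ^+ 2) / 2 =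
  ((p v - p u) * (p v + p u) - (q v - q u) * (q v + q u)) / 2 by lra.
rewrite normrM (@ger0_norm _ 2^-1)// ler_pdivrMr//.
apply: (le_trans (ler_normB _ _)); apply: (le_trans (lerD h1 h2)).
have Lm : 0 <= L * (m v - m u) by rewrite mulr_ge0 ?(ltW L0)//; lra.
have LL : 0 <= L ^+ 2 * (v - u) by rewrite mulr_ge0 ?sqr_ge0//; lra.
lra.
Qed.

(** The shift [c] allows normals beyond pi to be treated as normals of an upper boundary, for the
    opposite selection. *)
Lemma cap_integral c : mu.-integrable `[c, c + pi]
    (EFin \o (fun t => (p (t - c) ^+ 2 - q (t - c) ^+ 2) / 2)) ->
  \int[mu]_(t in `[c, c + pi]) ((p (t - c) ^+ 2 - q (t - c) ^+ 2) / 2) =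
  cap_area pi - cap_area 0.
Proof.
move=> Gi; have pi0 := pi_gt0 R.
rewrite (@Rintegral_itv_split _ _ c (c + pi / 2))//; [|lra|lra].
have part a b : c <= a -> a <= b -> b <= c + pi -> b <= c + pi / 2 \/ c + pi / 2 <= a ->
    \int[mu]_(t in `[a, b]) ((p (t - c) ^+ 2 - q (t - c) ^+ 2) / 2) =
    cap_area (b - c) - cap_area (a - c).
  move=> ca ab bc hab.
  apply: (@Rintegral_of_increments _ _ (fun t => cap_area (t - c))
     (fun t => 12 * L * m (t - c) + 4 * L ^+ 2 * (t - c))) => //.
  - exact: integrable_subitv Gi.
  - move=> u v au uv vb.
    have := @cap_area_increment (u - c) (v - c).
    have -> : v - c - (u - c) = v - u by lra.
    by apply; lra.
  - move=> u v au uv vb; apply: pedal_density_increment; lra.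
rewrite !part; try lra.
have -> : c + pi - c = pi by lra.
by rewrite subrr; lra.
Qed.

End cap_increments.
End cap.

(** * Asymptotics for large radii *)

Section angle_asymptotics.
Context {R : realType}.
Variables (K : set (R * R)) (x y : R -> R) (L : R).
Hypotheses (L0 : 0 < L) (KL : in_disc L K) (xyP : support_point K x y).
Hypothesis K_sym : symmetric_origin K.
Variables (r : R) (rL : 8 * L <= r).

Let mu := @lebesgue_measure R.
Let p t := dot (x t) (y t) t.
Let q t := dot (y t) (- x t) t.
Let r0 : 0 < r. Proof. by have := L0; have := rL; lra. Qed.

Local Notation alpha := (chord_half_angle x y r).
Local Notation alpha' := (chord_half_angle' x y r).
Local Notation chi := (second_normal L0 KL xyP K_sym rL).
Local Notation dw := (angle_derivative L0 KL xyP K_sym rL).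

Lemma inv_sqrt_support_ratio t :
  `|(Num.sqrt (1 - (p t / r) ^+ 2))^-1 - 1| <= 2 * (L / r).
Proof.
have /andP[h0 h1] := support_ratio L0 KL xyP K_sym rL t.
have /andP[] := sqrt_support_ratio L0 KL xyP K_sym rL t.
rewrite -/(p t) in h0 h1 *; set S := Num.sqrt _ => S0 S1.
have SE : S ^+ 2 = 1 - (p t / r) ^+ 2 by rewrite sqr_sqrtr//; nra.
have pL : p t / r <= L / r.
  rewrite ler_pM2r ?invr_gt0//.
  by have := support_normal_bound L0 KL xyP t; rewrite ler_norml => /andP[].
have Sp : 0 < S by lra.
rewrite ger0_norm; last by rewrite subr_ge0 invf_ge1.
have -> : S^-1 - 1 = (1 - S) / S by field; rewrite gt_eqF.
rewrite ler_pdivrMr//; nra.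
Qed.

Lemma chord_half_angle_approx t : `|r * alpha t - p t| <= 2 * L * (L / r).
Proof.
have /andP[h1 h2] := chord_half_angle_bounds L0 KL xyP K_sym rL t.
rewrite -/(p t) in h1 h2.
have hS := inv_sqrt_support_ratio t; set S := (Num.sqrt _)^-1 in hS h2.
have pL := support_normal_bound L0 KL xyP t; rewrite -/(p t) in pL.
have h3 := le_trans (ler_norm _) (normr_mul_le pL hS).
have {}h1 : p t <= r * alpha t by rewrite mulrC -ler_pdivrMr.
have {}h2 : r * alpha t <= p t * S.
  by rewrite mulrC -ler_pdivlMr// mulrAC.
by rewrite ger0_norm ?subr_ge0//; lra.
Qed.

Lemma chord_half_angle'_approx t : `|r * alpha' t - q t| <= 2 * L * (L / r).
Proof.
have hS := inv_sqrt_support_ratio t.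
have qL := support_tangent_bound L0 KL xyP t; rewrite -/(q t) in qL.
have -> : r * alpha' t - q t = q t * ((Num.sqrt (1 - (p t / r) ^+ 2))^-1 - 1).
  rewrite /chord_half_angle' -/(q t) -/(p t) mulrBr mulr1 !mulrA.
  by rewrite (mulrC r) mulfK// gt_eqF.
by apply: (le_trans (normr_mul_le qL hS)); lra.
Qed.

Lemma w_angle_approx t : `|r * (t - chi t) - 2 * p t| <= 8 * L * (L / r).
Proof.
have h1 := chord_half_angle_approx t; have h2 := chord_half_angle_approx (chi t).
have h3 := support_Lipschitz L0 KL xyP t (chi t).
have /andP[h4 h5] := second_normal_bounds L0 KL xyP K_sym rL t.
rewrite -/(p t) -/(p (chi t)) distrC (distrC (chi t)) (ger0_norm h4) in h3.
have h6 : L * (t - chi t) <= L * (4 * (L / r)) by rewrite ler_wpM2l// ltW.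
have -> : r * (t - chi t) - 2 * p t = (r * alpha t - p t) +
    (r * alpha (chi t) - p (chi t)) - (p t - p (chi t)).
  by rewrite second_normal_dist; ring.
move: h1 h2 h3; rewrite !ler_norml; lra.
Qed.

(** The difference of [q] at the two normals is kept: it need not be small at a jump, and vanishes
    in the limit where [q] is continuous. The denominator is at least 1/2, which doubles both
    terms. *)
Lemma angle_derivative_approx t :
  `|r * dw t - 2 * q t| <= 16 * L * (L / r) + 2 * `|q t - q (chi t)|.
Proof.
have h1 := chord_half_angle'_approx t; have h2 := chord_half_angle'_approx (chi t).
have h3 := chord_half_angle'_bound L0 KL xyP K_sym rL (chi t).
have qL := support_tangent_bound L0 KL xyP t; rewrite -/(q t) in qL.
have h4 : 2 * L / r <= 2^-1.
  by rewrite ler_pdivrMr//; have := rL; have := r0; lra.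
have h5 : 2^-1 <= 1 + alpha' (chi t) by move: h3; rewrite ler_norml; lra.
have h6 := normr_mul_le qL h3.
have h7 : 1 + alpha' (chi t) != 0 by rewrite gt_eqF//; lra.
have -> : r * dw t - 2 * q t = ((r * alpha' t - q t) +
    (r * alpha' (chi t) - q (chi t)) - (q t - q (chi t)) -
    2 * (q t * alpha' (chi t))) / (1 + alpha' (chi t)).
  by rewrite /angle_derivative; field.
rewrite normrM normfV (@gtr0_norm _ (1 + _)); last by lra.
rewrite ler_pdivrMr; last by lra.
have n0 := normr_ge0 (q t - q (chi t)).
have LL : 0 <= L * (L / r) by rewrite mulr_ge0// ?divr_ge0// ltW.
apply: (@le_trans _ _ (8 * L * (L / r) + `|q t - q (chi t)|)); last by nra.
have := ler_norm (q t - q (chi t)); have := ler_norm (- (q t - q (chi t))).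
rewrite normrN.
have E : L * (2 * L / r) = 2 * (L * (L / r)) by ring.
rewrite E in h6; move: h1 h2 h6; rewrite !ler_norml -!mulrA; lra.
Qed.

Definition angle_singular := [set t | ~ {for t, continuous q}] `|`
  [set t | ~ {for chi t, continuous q}].

Lemma countable_angle_singular : countable angle_singular.
Proof.
have cN := countable_support_corner L0 KL xyP.
rewrite /angle_singular -bigcup2E; apply: bigcup_countable => // -[|[|n]] _ //=.
(* Injectivity of [chi] makes the preimage of the jumps as small as its image. *)
rewrite -(eq_countable (inj_card_eq (f := chi) _)).
  by apply: sub_countable cN; apply: subset_card_le => _ [t /= h <-].
by move=> s t _ _; exact: injective_second_normal.
Qed.

Lemma is_derive_w_angle_ae t : ~ angle_singular t ->
  is_derive t 1 (w_angle K r) (dw t).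
Proof.
by move=> /not_orP[/contrapT h1 /contrapT h2]; exact: is_derive_w_angle.
Qed.

(** A stand-in for the integrand made of functions that are meaningful for every [t], whereas
    [derive1] takes a default value at singular points. *)
Definition angle_density t := (r * (t - chi t)) ^+ 2 - (r * dw t) ^+ 2.

Lemma integrandE t : ~ angle_singular t -> integrand K r t = angle_density t.
Proof.
move=> /is_derive_w_angle_ae dwt.
rewrite /integrand /angle_density (w_angleE L0 KL xyP K_sym rL) derive1E derive_val.
by ring.
Qed.

Lemma measurable_angle_density (A : set R) : measurable A ->
  measurable_fun A angle_density.
Proof.
move=> mA; apply: measurable_funTS.
have mchi : measurable_fun setT chi.
  by apply: continuous_measurable_fun; exact: continuous_second_normal.
have ma' : measurable_fun setT alpha'.
  apply: measurable_funM.
    by apply: measurable_funM => //; exact: measurable_support_tangent L0 KL xyP _ _.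
  apply: continuous_measurable_fun => t.
  have hS := sqrt_support_ratio L0 KL xyP K_sym rL t.
  apply: cvgV; first by rewrite gt_eqF//; lra.
  apply: continuous_comp; last exact: sqrt_continuous.
  apply: cvgB; first exact: cvg_cst.
  have cpr : p s / r @[s --> t] --> p t / r.
    by apply: cvgMl; exact: continuous_support L0 KL xyP t.
  exact: (cvgM cpr cpr).
have mac : measurable_fun setT (alpha' \o chi) by exact: measurableT_comp.
apply: measurable_funB; apply: measurable_funX; apply: measurable_funM => //.
  exact: measurable_funB.
apply: measurable_funM; first exact: measurable_funD.
(* The denominator is at least 1/2; truncating it there turns the inverse into a continuous
   function. *)
have -> : (fun t => (1 + alpha' (chi t))^-1) =
    (fun t => (Num.max (2^-1) (1 + alpha' (chi t)))^-1).
  apply/funext => t; congr (_^-1); rewrite max_r//.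
  have := chord_half_angle'_bound L0 KL xyP K_sym rL (chi t).
  have h4 : 2 * L / r <= 2^-1.
    by rewrite ler_pdivrMr//; have := rL; have := r0; lra.
  by rewrite ler_norml; lra.
have m1 : measurable_fun setT (fun z : R => (Num.max (2^-1) z)^-1).
  apply: continuous_measurable_fun => z.
  apply: cvgV; first by rewrite gt_eqF// lt_max invr_gt0 ltr0n.
  exact: (@continuous_max R R (fun=> 2^-1 : R^o) (fun z => z : R^o) z (@cvg_cst _ _ _ _ _) cvg_id).
have m2 : measurable_fun setT (fun t => 1 + alpha' (chi t)) by exact: measurable_funD.
exact: (measurableT_comp m1 m2).
Qed.

(** The constant is 4^2 + 8^2, from r w at most 4 L and r w' at most 8 L. It is uniform in [r], as
    domination requires. *)
Lemma angle_density_bound t : `|angle_density t| <= 80 * L ^+ 2.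
Proof.
have h1 := angle_derivative_bound L0 KL xyP K_sym rL t.
have /andP[h2 h3] := second_normal_bounds L0 KL xyP K_sym rL t.
have h4 : `|r * (t - chi t)| <= 4 * L.
  rewrite normrM (gtr0_norm r0) (ger0_norm h2).
  have -> : 4 * L = r * (4 * (L / r)) by field; rewrite gt_eqF.
  by rewrite ler_wpM2l// ltW.
have := normr_mul_le h1 h1; have := normr_mul_le h4 h4.
rewrite /angle_density -!expr2 => h5 h6.
rewrite (le_trans (ler_normB _ _))//; lra.
Qed.

Lemma measurable_integrand (A : set R) : measurable A ->
  measurable_fun A (integrand K r).
Proof.
move=> mA; exact: (measurable_eq_off_countable mA countable_angle_singular
  (fun t => @integrandE t) (measurable_angle_density mA)).
Qed.

Lemma angle_singular_negligible (P : R -> Prop) :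
  (forall t, ~ angle_singular t -> P t) -> {ae mu, forall t, P t}.
Proof.
move=> h; exists angle_singular; split.
- by apply: countable_measurable => //; exact: countable_angle_singular.
- exact: countable_lebesgue_measure0 countable_angle_singular.
- by move=> t /= nP; apply: contrapT => /h.
Qed.

Lemma ae_eq_integrand (A : set R) :
  ae_eq mu A (EFin \o integrand K r) (EFin \o angle_density).
Proof.
by apply: angle_singular_negligible => t /integrandE /= ->.
Qed.

Lemma integrable_integrand a b :
  mu.-integrable `[a, b] (fun t => (integrand K r t)%:E).
Proof.
have := @bounded_integrable_itv _ angle_density a b _
  (measurable_angle_density (measurable_itv _)) (fun t _ => angle_density_bound t).
move=> /integrableP[m1 i1]; apply/integrableP; split.
  by apply/measurable_EFinP; exact: measurable_integrand.
apply: le_lt_trans i1; rewrite le_eqVlt; apply/predU1P; left.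
apply: ae_eq_integral => //.
- by apply: measurableT_comp => //; apply/measurable_EFinP; exact: measurable_integrand.
- by apply: measurableT_comp.
- by apply: angle_singular_negligible => t /integrandE /= ->.
Qed.

Lemma integral_integrandE a b : \int[mu]_(t in `[a, b]) integrand K r t =
  \int[mu]_(t in `[a, b]) angle_density t.
Proof.
congr fine; apply: ae_eq_integral => //.
- by apply/measurable_EFinP; exact: measurable_integrand.
- by apply/measurable_EFinP; exact: measurable_angle_density.
- exact: ae_eq_integrand.
Qed.

End angle_asymptotics.

(** * Limit of the integral *)

Section area_from_support.
Context {R : realType}.
Let mu := @lebesgue_measure R.

(** At the normals 0 and pi one has p q = x y, so the correction terms of [cap_area] cancel. *)
Lemma cap_area_total (x y Phi : R -> R) :
  cap_area x y Phi pi - cap_area x y Phi 0 = Phi (x pi) - Phi (x 0).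
Proof.
by rewrite /cap_area /dot cospi sinpi cos0 sin0; lra.
Qed.

Lemma support_point_opp_shift (K : set (R * R)) (x y : R -> R) :
  symmetric_origin K -> support_point K x y ->
  support_point K (fun t => - x (t + pi)) (fun t => - y (t + pi)).
Proof.
move=> sK xyP t; split; first exact/sK/(xyP _).1.
move=> a b Kab; have := (xyP (t + pi)).2 a b Kab.
have := (xyP (t + pi)).2 _ _ (sK _ _ Kab); rewrite !dotDpi !dotN; lra.
Qed.

Section body.
Variables (K : set (R * R)) (x y : R -> R) (L : R).
Hypotheses (L0 : 0 < L) (KL : in_disc L K) (xyP : support_point K x y).
Hypotheses (K_compact : compact K) (K_convex : convex_planar K).
Hypothesis K_sym : symmetric_origin K.

Let p t := dot (x t) (y t) t.
Let q t := dot (y t) (- x t) t.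

Definition pedal_density t := p t ^+ 2 - q t ^+ 2.

Lemma measurable_pedal_density (A : set R) : measurable A ->
  measurable_fun A pedal_density.
Proof.
move=> mA; apply: measurable_funTS; apply: measurable_funB; apply: measurable_funX.
  by apply: continuous_measurable_fun; exact: continuous_support L0 KL xyP.
exact: measurable_support_tangent L0 KL xyP _ _.
Qed.

Lemma integrable_pedal_density a b c :
  mu.-integrable `[a, b] (EFin \o (fun t => c * pedal_density t)).
Proof.
apply: (@bounded_integrable_itv _ _ _ _ (`|c| * (L * L + L * L))).
  by apply: measurable_funM => //; exact: measurable_pedal_density.
move=> t _; rewrite normrM ler_wpM2l// (le_trans (ler_normB _ _))// !expr2.
have hp := support_normal_bound L0 KL xyP t.
have hq := support_tangent_bound L0 KL xyP t.
by apply: lerD; exact: normr_mul_le.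
Qed.

Let Kx a b : K (a, b) -> - x 0 <= a <= x 0.
Proof.
move=> Kab; have := (xyP 0).2 _ _ Kab; have := (xyP 0).2 _ _ (K_sym Kab).
by rewrite /dot cos0 sin0; lra.
Qed.

Let x0_section s : - x 0 <= s <= x 0 -> exists b, K (s, b).
Proof.
move=> sx; have [x00|x00] := eqVneq (x 0) 0.
  exists (y 0); have -> : s = x 0 by lra.
  exact: (xyP 0).1.
have x0 : 0 < x 0 by rewrite lt_neqAle eq_sym x00; lra.
have l01 : 0 <= (s + x 0) / (2 * x 0) <= 1.
  by rewrite divr_ge0 ?ler_pdivrMr//; lra.
have := convex_planarE K_convex l01 (xyP 0).1 (K_sym (xyP 0).1).
have -> : (s + x 0) / (2 * x 0) * x 0 + (1 - (s + x 0) / (2 * x 0)) * - x 0 = s.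
  by field.
by move=> Ks; eexists; exact: Ks.
Qed.

Lemma support_point_pi : x pi = - x 0.
Proof.
have := (xyP pi).2 _ _ (K_sym (xyP 0).1); have := Kx (xyP pi).1.
by rewrite /dot cospi sinpi; lra.
Qed.

(** Normals in [0, pi] sweep the upper boundary and give the integral of [f]; those in [pi, 2 pi],
    after passing to opposite points, give that of f(- s). *)
Lemma area_support :
  area K = (2^-1 * \int[mu]_(t in `[0, 2 * pi]) pedal_density t)%:E.
Proof.
have pi0 := pi_gt0 R.
have [f fP] := upper_graph_exists K_compact x0_section.
have fi := integrable_upper_graph L0 KL K_convex fP Kx.
have fNi := integrable_upper_graphN L0 KL K_convex fP Kx.
rewrite (area_upper_graph L0 KL K_convex K_sym fP Kx) -/mu; congr EFin.
have xyP' := support_point_opp_shift K_sym xyP.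
have Gi a b : mu.-integrable `[a, b] (EFin \o (fun t => pedal_density t / 2)).
  have := integrable_pedal_density a b 2^-1.
  by apply: eq_integrable => // t _ /=; rewrite mulrC.
have e1 : (fun t => (dot (x (t - 0)) (y (t - 0)) (t - 0) ^+ 2 -
    dot (y (t - 0)) (- x (t - 0)) (t - 0) ^+ 2) / 2) = (fun t => pedal_density t / 2).
  by apply/funext => t; rewrite subr0.
have e2 : (fun t => (dot (- x (t - pi + pi)) (- y (t - pi + pi)) (t - pi) ^+ 2 -
    dot (- y (t - pi + pi)) (- - x (t - pi + pi)) (t - pi) ^+ 2) / 2) =
    (fun t => pedal_density t / 2).
  apply/funext => t; rewrite subrK !dotN /pedal_density /p /q.
  by have := dotDpi (x t) (y t) (t - pi); have := dotDpi (y t) (- x t) (t - pi);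
    rewrite subrK => -> ->; rewrite !sqrrN.
have I1 := cap_integral L0 KL K_convex xyP fP Kx (affine_increments_right fi) (c := 0).
rewrite e1 add0r in I1; have {}I1 := I1 (Gi _ _).
have I2 := cap_integral L0 KL K_convex xyP' fP Kx (affine_increments_left fNi) (c := pi).
rewrite e2 in I2; have {}I2 := I2 (Gi _ _).
rewrite cap_area_total support_point_pi set_itv1 Rintegral_set1 subr0 in I1.
rewrite cap_area_total add0r support_point_pi opprK in I2.
(* The selection need not be periodic, but the abscissa of a contact point with horizontal normal is
   determined. *)
have E2pi : x (pi + pi) = x 0.
  have := (xyP' pi).2 _ _ (K_sym (xyP 0).1); have := Kx (xyP (pi + pi)).1.
  by rewrite /dot cospi sinpi; lra.
rewrite E2pi opprK set_itv1 Rintegral_set1 subr0 in I2.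
rewrite -I1 -I2 -Rintegral_itv_split//; [|lra|lra].
have -> : pi + pi = 2 * pi :> R by lra.
rewrite -RintegralZl//; last first.
  by have := integrable_pedal_density 0 (2 * pi) 1; apply: eq_integrable => // t _ /=; rewrite mul1r.
by apply: eq_Rintegral => t _; rewrite mulrC.
Qed.

Lemma cvg_angle_density (v : nat -> R) (vL : forall n, 8 * L <= v n) t :
  v n @[n --> \oo] --> +oo -> {for t, continuous q} ->
  angle_density L0 KL xyP K_sym (vL n) t @[n --> \oo] --> 4 * pedal_density t.
Proof.
move=> voo cq.
have v0 : L / v n @[n --> \oo] --> 0.
  rewrite -[X in _ --> X](mulr0 L); apply: cvgMr.
  apply/gtr0_cvgV0 => //; apply: nearW => n.
  by have := vL n; have := L0; lra.
have c0 c : c * (L / v n) @[n --> \oo] --> 0.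
  by rewrite -[X in _ --> X](mulr0 c); exact: cvgMr.
pose chi n := second_normal L0 KL xyP K_sym (vL n) t.
have chit : chi n @[n --> \oo] --> t.
  apply: cvg_of_dist_le (c0 4) => n.
  have /andP[h1 h2] := second_normal_bounds L0 KL xyP K_sym (vL n) t.
  by rewrite distrC ger0_norm.
have qchi : `|q t - q (chi n)| @[n --> \oo] --> 0.
  rewrite -[X in _ --> X](@normr0 _ R) -[X in `|X|](subrr (q t)).
  apply: cvg_norm; apply: cvgB; first exact: cvg_cst.
  exact: continuous_cvg cq chit.
have h1 := cvg_of_dist_le (fun n => w_angle_approx L0 KL xyP K_sym (vL n) t) (c0 (8 * L)).
have h2 : v n * angle_derivative L0 KL xyP K_sym (vL n) t @[n --> \oo] --> 2 * q t.
  apply: (cvg_of_dist_le (fun n => angle_derivative_approx L0 KL xyP K_sym (vL n) t)).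
  rewrite -[X in _ --> X]addr0; apply: cvgD; first exact: c0.
  by rewrite -[X in _ --> X](mulr0 2); exact: cvgMr.
have -> : 4 * pedal_density t = (2 * p t) * (2 * p t) - (2 * q t) * (2 * q t).
  by rewrite /pedal_density; ring.
exact: (cvgB (cvgM h1 h1) (cvgM h2 h2)).
Qed.

Lemma cvg_integral_angle_density (v : nat -> R) (vL : forall n, 8 * L <= v n) :
  v n @[n --> \oo] --> +oo ->
  \int[mu]_(t in `[0, 2 * pi]) angle_density L0 KL xyP K_sym (vL n) t
    @[n --> \oo] --> 4 * \int[mu]_(t in `[0, 2 * pi]) pedal_density t.
Proof.
move=> voo.
have i4 := integrable_pedal_density 0 (2 * pi) 4.
rewrite -RintegralZl//; last first.
  by have := integrable_pedal_density 0 (2 * pi) 1; apply: eq_integrable => // t _ /=; rewrite mul1r.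
pose g n t := (angle_density L0 KL xyP K_sym (vL n) t)%:E.
pose g0 t := (4 * pedal_density t)%:E.
have mg n : measurable_fun `[0, 2 * pi] (g n).
  by apply/measurable_EFinP; exact: measurable_angle_density.
have mg0 : measurable_fun `[0, 2 * pi] g0 by case/integrableP : i4.
have gg0 : {ae mu, forall t, `[0, 2 * pi] t -> g ^~ t @ \oo --> g0 t}.
  exists [set t | ~ {for t, continuous q}]; split.
  - by apply: countable_measurable => //; exact: countable_support_corner L0 KL xyP.
  - exact: countable_lebesgue_measure0 (countable_support_corner L0 KL xyP).
  - move=> t /= nt cq; apply: nt => _; apply/fine_cvgP; split; first exact: nearW.
    exact: cvg_angle_density.
have gb : {ae mu, forall t n, `[0, 2 * pi] t -> (`|g n t| <= (80 * L ^+ 2)%:E)%E}.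
  by apply: aeW => t n _; rewrite lee_fin; exact: angle_density_bound.
have ib : mu.-integrable `[0, 2 * pi] (fun=> (80 * L ^+ 2)%:E).
  by apply: (@bounded_integrable_itv _ (cst (80 * L ^+ 2)) 0 (2 * pi) `|80 * L ^+ 2|).
have [_ _ h] := @dominated_convergence _ _ R mu _ (measurable_itv _) _ _ _ mg mg0 gg0 ib gb.
apply: fine_cvg.
rewrite /Rintegral fineK; last exact: integrable_fin_num.
exact: h.
Qed.

Lemma cvg_integral_integrand :
  \int[mu]_(t in `[0, 2 * pi]) integrand K r t @[r --> +oo] -->
  4 * \int[mu]_(t in `[0, 2 * pi]) pedal_density t.
Proof.
apply/cvg_pinftyP => u uoo.
(* The angle functions exist only with a proof of [8 * L <= r], so the sequence is truncated below;
   it is unchanged for large [n]. *)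
pose v n := Num.max (u n) (8 * L).
have vL n : 8 * L <= v n by rewrite le_max lexx orbT.
have voo : v n @[n --> \oo] --> +oo.
  apply/cvgryPge => A; move/cvgryPge : uoo => /(_ A); apply: filterS => n.
  by move=> An; rewrite le_max An.
apply: cvg_trans (cvg_integral_angle_density vL voo).
apply: near_eq_cvg; near=> n.
have -> : u n = v n.
  rewrite /v max_l//; near: n.
  by move/cvgryPge : uoo; exact.
by rewrite (integral_integrandE L0 KL xyP K_sym (vL n)).
Unshelve. all: by end_near. Qed.

End body.
End area_from_support.

Theorem corollary3p3 (R : realType) (K : set (R * R)) (F : R)
    (K_compact : compact K)
    (K_convex : convex_planar K)
    (K_C2 : C2_boundary K)
    (K_sym : symmetric_origin K)
    (K_area : area K = F%:E) :
  (\forall r \near +oo,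
     {ae @lebesgue_measure R, forall phi, derivable (w_angle K r) phi 1} /\
     (@lebesgue_measure R).-integrable `[0, 2 * pi]
       (fun phi => (integrand K r phi)%:E)) /\
  let J := fun r =>
    \int[@lebesgue_measure R]_(phi in `[0, 2 * pi]) integrand K r phi in
  cvg (J r @[r --> +oo]) /\
  F = 8^-1 * lim (J r @[r --> +oo]).
Proof.
have K0 : K !=set0.
  have [l [x [y [_ _ _ _ [_ bE]]]]] := K_C2.
  have : boundary K (x 0, y 0) by rewrite bE; exists 0.
  move=> [clK _]; exists (x 0, y 0).
  by move: clK; rewrite -(closure_id _).1//; exact: compact_closed.
have [L L0 KL] := compact_in_disc K_compact.
have [x [y xyP]] := support_point_exists K_compact K0.
have Jcvg := cvg_integral_integrand L0 KL xyP K_sym.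
split; last first.
  split; first by apply/cvg_ex; eexists; exact: Jcvg.
  rewrite (cvg_lim _ Jcvg)//.
  (* The limit is 4 times and the area half of the same integral, whence 1/8. *)
  move: K_area; rewrite (area_support L0 KL xyP K_compact K_convex K_sym) => -[<-].
  lra.
near=> r.
have rL : 8 * L <= r by near: r; apply: nbhs_pinfty_ge; exact: num_real.
split.
  have := @angle_singular_negligible R K x y L L0 KL xyP K_sym r rL
    (fun t => derivable (w_angle K r) t 1); apply => t nt.
  by case: (is_derive_w_angle_ae nt).
exact: (integrable_integrand L0 KL xyP K_sym rL).
Unshelve. all: by end_near. Qed.
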